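(* Assume (A0)–(A3) and let $\{(x^k,\lambda^k)\}$ be generated by the NEPJ-ADMM (with parameters satisfying $\delta_i>0$, $i=1,\dots,p$). Let $$\Delta\mathcal{L}_0:=\mathcal{L}_\beta(x^0,\lambda^0)-v(\beta)+\eta_0,\qquad \eta_0:=\frac{m_p}{4M_p^2}\|A_p^*\lambda^0-\nabla f_p(x_p^0)\|^2,$$ and let $$\delta_\lambda:=\left[\frac{\theta\gamma_\theta(p+1)}{\sigma^+_{A_p}\min_{1\le l\le p}\delta_l}\Big(2\beta^2\|A_p^*\|^2\max_{1\le l\le p-1}\|A_l\|^2+L_p^2+2M_p^2\Big)\right]^{-1}.$$ Then: (a) $\Delta\mathcal{L}_0\ge 0$; (b) for every $k\ge1$, $0\in\partial f_i(x_i^k)-A_i^*\hat\lambda^k+R_i^k$ for $i=1,\dots,p$, and there exists an index $j\le k$ such that $$\|R_i^j\|\le\Big[\sum_{l=1,l\ne i}^p\beta\|A_i^*A_l\|+M_i\Big]\sqrt{\frac{2\Delta\mathcal{L}_0}{k\min_{1\le l\le p}\delta_l}},\quad i=1,\dots,p,\qquad \Big\|\sum_{i=1}^pA_ix_i^j-b\Big\|\le\frac{1}{\beta\theta}\sqrt{\frac{2\Delta\mathcal{L}_0}{k\delta_\lambda}}.$$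
   Context: Problem: let $p\ge2$, $f_i:\mathbb{R}^{n_i}\to(-\infty,\infty]$ ($i=1,\dots,p$), $A_i\in\mathbb{R}^{d\times n_i}$, $b\in\mathbb{R}^d$, and consider $\min\{\sum_{i=1}^pf_i(x_i):\sum_{i=1}^pA_ix_i=b\}$. For $\beta>0$ the augmented Lagrangian is $\mathcal{L}_\beta(x_1,\dots,x_p,\lambda)=\sum_{i=1}^pf_i(x_i)-\langle\lambda,\sum_{i=1}^pA_ix_i-b\rangle+\frac\beta2\|\sum_{i=1}^pA_ix_i-b\|^2$. Standing assumptions: (A0) $f_1,\dots,f_{p-1}$ are proper lower semicontinuous; (A1) $A_p\ne0$ and $\mathrm{Im}(A_p)\supseteq\{b\}\cup\mathrm{Im}(A_1)\cup\dots\cup\mathrm{Im}(A_{p-1})$; (A2) $f_p:\mathbb{R}^{n_p}\to\mathbb{R}$ is differentiable with $L_p$-Lipschitz gradient; (A3) there is $\bar\beta\ge0$ with $v(\bar\beta)>-\infty$, where $v(\beta):=\inf_{x}\{\sum_{i=1}^pf_i(x_i)+\frac\beta2\|\sum_{i=1}^pA_ix_i-b\|^2\}$. $\partial$ is the limiting (Mordukhovich) subdifferential; $A^*$ is the transpose; $\sigma^+_{A_p}$ is the smallest positive eigenvalue of $A_p^*A_p$. Distance generating functions: for $Z\subseteq\mathbb{R}^s$ and $0<m\le M$, $\mathcal{D}_Z(m,M)$ is the class of real-valued functions $w$ differentiable on $Z$ with $w(z')-w(z)-\langle\nabla w(z),z'-z\rangle\ge\frac m2\|z'-z\|^2$ and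 $\|\nabla w(z)-\nabla w(z')\|\le M\|z-z'\|$ for all $z,z'\in Z$; its Bregman distance is $(dw)_z(z'):=w(z')-w(z)-\langle\nabla w(z),z'-z\rangle$ for $z\in Z$, $z'\in\mathbb{R}^s$. NEPJ-ADMM: let $Z_i=\mathrm{dom} f_i$, $\gamma_\theta:=\theta/(1-|\theta-1|)^2$. Pick $(x_1^0,\dots,x_p^0,\lambda^0)\in Z_1\times\dots\times Z_p\times\mathbb{R}^d$, $\alpha>0$, $\beta\ge\bar\beta$ with $\beta>0$, $M_i\ge m_i>0$, $\theta\in(0,2)$ such that $\delta_i:=\frac{m_i}{4}-\big(\frac{p-2+\alpha}{2}+\frac{2\gamma_\theta(p+1)}{\sigma^+_{A_p}}\|A_p^*\|^2\big)\beta\max_{1\le l\le p-1}\|A_l\|^2>0$ for $i=1,\dots,p-1$ and $\delta_p:=\frac{m_p}{4}-\big(\frac{\beta(p-1)\|A_p\|^2}{2\alpha}+\frac{\gamma_\theta(p+1)(L_p^2+2M_p^2)}{\beta\sigma^+_{A_p}}\big)>0$. For $k\ge1$: for each $i$ choose $w_i^k\in\mathcal{D}_{Z_i}(m_i,M_i)$ and let $x_i^k$ be an optimal solution (assumed to exist) of $\min_{x_i}\{\mathcal{L}_\beta(x^{k-1}_{<i},x_i,x^{k-1}_{>i},\lambda^{k-1})+(dw_i^k)_{x_i^{k-1}}(x_i)\}$, where $(x_{<i},x_i,x_{>i})$ denotes $(x_1,\dots,x_p)$ with the $i$-th block singled out; then set $\lambda^k=\lambda^{k-1}-\theta\beta(\sum_{i=1}^pA_ix_i^k-b)$.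 Write $x^k=(x_1^k,\dots,x_p^k)$. Notation: $\hat\lambda^k:=\lambda^{k-1}-\beta(\sum_iA_ix_i^k-b)$; $\Delta x_i^k:=x_i^k-x_i^{k-1}$; $\Delta w_i^k:=\nabla w_i^k(x_i^k)-\nabla w_i^k(x_i^{k-1})$; $R_i^k:=-\sum_{j\ne i}\beta A_i^*A_j\Delta x_j^k+\Delta w_i^k$ for $k\ge1$. *)

(* Defs.v *)
From Stdlib Require Import Reals ClassicalEpsilon PeanoNat.
From mathcomp Require Import ssreflect ssrfun ssrbool eqtype ssrnat seq fintype bigop.
Set Implicit Arguments.
Unset Strict Implicit.
Local Open Scope R_scope.

Definition vec (n : nat) := 'I_n -> R.
Definition mat (d n : nat) := 'I_d -> 'I_n -> R.

Definition vzero (n : nat) : vec n := fun _ => 0.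
Definition vadd n (u v : vec n) : vec n := fun t => u t + v t.
Definition vsub n (u v : vec n) : vec n := fun t => u t - v t.
Definition vscal n (c : R) (u : vec n) : vec n := fun t => c * u t.
Definition dot n (u v : vec n) : R := \big[Rplus/0]_(t < n) (u t * v t).
Definition vnorm n (u : vec n) : R := sqrt (dot u u).

Definition mapply d n (A : mat d n) (x : vec n) : vec d :=
  fun r => \big[Rplus/0]_(c < n) (A r c * x c).
Definition mT d n (A : mat d n) : mat n d := fun c r => A r c.
Definition mmul a b c (A : mat a b) (B : mat b c) : mat a c :=
  fun r s => \big[Rplus/0]_(t < b) (A r t * B t s).

Definition pickR (P : R -> Prop) : R :=
  match excluded_middle_informative (exists r, P r) with
  | left h => proj1_sig (constructive_indefinite_description P h)
  | right _ => 0
  end.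

Definition is_glb (E : R -> Prop) (m : R) : Prop :=
  (forall r, E r -> m <= r) /\
  (forall m', (forall r, E r -> m' <= r) -> m' <= m).

Definition opnorm m n (F : vec m -> vec n) : R :=
  pickR (is_lub (fun r => exists x : vec m, vnorm x <= 1 /\ r = vnorm (F x))).

Definition is_eig n (Mx : mat n n) (mu : R) : Prop :=
  exists v : vec n, v <> @vzero n /\ mapply Mx v = vscal mu v.
Definition smallest_pos_eig n (Mx : mat n n) : R :=
  pickR (fun s => 0 < s /\ is_eig Mx s /\
                  forall mu, 0 < mu -> is_eig Mx mu -> s <= mu).

(* ---------- extended reals (-oo, +oo] : None stands for +oo ---------- *)
Definition ele (a b : option R) : Prop :=
  match a, b with
  | _, None => True
  | None, Some _ => False
  | Some x, Some y => x <= y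
  end.
Definition rlt (r : R) (a : option R) : Prop :=
  match a with None => True | Some y => r < y end.
Definition oadd (a b : option R) : option R :=
  match a, b with Some x, Some y => Some (x + y) | _, _ => None end.
Definition rv (a : option R) : R := match a with Some r => r | None => 0 end.

Definition dom n (f : vec n -> option R) (x : vec n) : Prop := f x <> None.
Definition proper_fn n (f : vec n -> option R) : Prop := exists x, dom f x.
Definition lsc n (f : vec n -> option R) : Prop :=
  forall (x : vec n) (r : R), rlt r (f x) ->
    exists del, 0 < del /\ forall y, vnorm (vsub y x) < del -> rlt r (f y).

Definition vconv n (u : nat -> vec n) (x : vec n) : Prop :=
  forall eps, 0 < eps -> exists N : nat, forall k : nat, (N <= k)%N ->
    vnorm (vsub (u k) x) < eps.

Definition frechet_subdiff n (f : vec n -> option R) (x v : vec n) : Prop :=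
  dom f x /\
  forall eps, 0 < eps -> exists del, 0 < del /\
    forall y, vnorm (vsub y x) < del ->
      ele (Some (rv (f x) + dot v (vsub y x) - eps * vnorm (vsub y x))) (f y).

Definition limiting_subdiff n (f : vec n -> option R) (x v : vec n) : Prop :=
  dom f x /\
  exists (xs vs : nat -> vec n),
    vconv xs x /\ Un_cv (fun k => rv (f (xs k))) (rv (f x)) /\
    (forall k, frechet_subdiff f (xs k) (vs k)) /\ vconv vs v.

Definition has_grad n (h : vec n -> R) (x g : vec n) : Prop :=
  forall eps, 0 < eps -> exists del, 0 < del /\
    forall y, vnorm (vsub y x) < del ->
      Rabs (h y - h x - dot g (vsub y x)) <= eps * vnorm (vsub y x).

Definition in_D n (Z : vec n -> Prop) (m M : R) (w : vec n -> R) (gw : vec n -> vec n) : Prop :=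
  (forall z, Z z -> has_grad w z (gw z)) /\
  (forall z z', Z z -> Z z' ->
      w z' - w z - dot (gw z) (vsub z' z) >= m / 2 * (vnorm (vsub z' z)) ^ 2) /\
  (forall z z', Z z -> Z z' -> vnorm (vsub (gw z) (gw z')) <= M * vnorm (vsub z z')).

Definition breg n (w : vec n -> R) (gw : vec n -> vec n) (z z' : vec n) : R :=
  w z' - w z - dot (gw z) (vsub z' z).

(* block vectors x = (x_1,...,x_p) are indexed by i = 0..p-1 (paper's i-1) *)
Definition resid (p : nat) (n : nat -> nat) d (A : forall i, mat d (n i)) (b : vec d)
  (x : forall i, vec (n i)) : vec d :=
  fun r => (\big[Rplus/0]_(i < p) mapply (A i) (x i) r) - b r.

Definition fsum (p : nat) (n : nat -> nat) (f : forall i, vec (n i) -> option R)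
  (x : forall i, vec (n i)) : option R :=
  \big[oadd/Some 0]_(i < p) f i (x i).

Definition Lag (p : nat) (n : nat -> nat) d (A : forall i, mat d (n i)) (b : vec d)
  (f : forall i, vec (n i) -> option R) (beta : R) (x : forall i, vec (n i)) (lam : vec d)
  : option R :=
  oadd (fsum p f x)
       (Some (- dot lam (resid p A b x) + beta / 2 * (vnorm (resid p A b x)) ^ 2)).

Definition pen_set (p : nat) (n : nat -> nat) d (A : forall i, mat d (n i)) (b : vec d)
  (f : forall i, vec (n i) -> option R) (beta : R) : R -> Prop :=
  fun r => exists x : forall i, vec (n i),
    oadd (fsum p f x) (Some (beta / 2 * (vnorm (resid p A b x)) ^ 2)) = Some r.
Definition vval (p : nat) (n : nat -> nat) d (A : forall i, mat d (n i)) (b : vec d)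
  (f : forall i, vec (n i) -> option R) (beta : R) : R :=
  pickR (is_glb (pen_set p A b f beta)).

Definition upd (n : nat -> nat) (x : forall j, vec (n j)) (i : nat) (y : vec (n i))
  : forall j, vec (n j) :=
  fun j => match Nat.eq_dec i j with
           | left e => eq_rect i (fun k => vec (n k)) y j e
           | right _ => x j
           end.

Definition gammaT (theta : R) : R := theta / (1 - Rabs (theta - 1)) ^ 2.

Definition maxA2 (p : nat) (n : nat -> nat) d (A : forall i, mat d (n i)) : R :=
  \big[Rmax/0]_(l < p.-1) (opnorm (mapply (A l))) ^ 2.

Definition sigAp (p : nat) (n : nat -> nat) d (A : forall i, mat d (n i)) : R :=
  smallest_pos_eig (mmul (mT (A p.-1)) (A p.-1)).

(* delta_{i+1}, for i = 0..p-1 (index p-1 is the paper's block p) *)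
Definition delta (p : nat) (n : nat -> nat) d (A : forall i, mat d (n i))
  (Lp beta alpha theta : R) (m M : nat -> R) (i : nat) : R :=
  if (i < p.-1)%N then
    m i / 4 - ((INR p - 2 + alpha) / 2
               + 2 * gammaT theta * (INR p + 1) / sigAp p A
                   * (opnorm (mapply (mT (A p.-1)))) ^ 2) * beta * maxA2 p A
  else
    m p.-1 / 4 - (beta * (INR p - 1) * (opnorm (mapply (A p.-1))) ^ 2 / (2 * alpha)
                  + gammaT theta * (INR p + 1) * (Lp ^ 2 + 2 * (M p.-1) ^ 2)
                    / (beta * sigAp p A)).

Definition min_delta (p : nat) (n : nat -> nat) d (A : forall i, mat d (n i))
  (Lp beta alpha theta : R) (m M : nat -> R) : R :=
  \big[Rmin/delta p A Lp beta alpha theta m M 0]_(l < p) delta p A Lp beta alpha theta m M l.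

Definition delta_lam (p : nat) (n : nat -> nat) d (A : forall i, mat d (n i))
  (Lp beta alpha theta : R) (m M : nat -> R) : R :=
  / (theta * gammaT theta * (INR p + 1) / (sigAp p A * min_delta p A Lp beta alpha theta m M)
     * (2 * beta ^ 2 * (opnorm (mapply (mT (A p.-1)))) ^ 2 * maxA2 p A
        + Lp ^ 2 + 2 * (M p.-1) ^ 2)).

Definition lamhat (p : nat) (n : nat -> nat) d (A : forall i, mat d (n i)) (b : vec d)
  (beta : R) (x : nat -> forall i, vec (n i)) (lam : nat -> vec d) (k : nat) : vec d :=
  vsub (lam k.-1) (vscal beta (resid p A b (x k))).

Definition Rres (p : nat) (n : nat -> nat) d (A : forall i, mat d (n i)) (beta : R)
  (gw : nat -> forall i, vec (n i) -> vec (n i)) (x : nat -> forall i, vec (n i))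
  (k i : nat) : vec (n i) :=
  vadd (vscal (-1) (fun t => \big[Rplus/0]_(j < p | nat_of_ord j != i)
          (beta * mapply (mT (A i)) (mapply (A j) (vsub (x k j) (x k.-1 j))) t)))
       (vsub (gw k i (x k i)) (gw k i (x k.-1 i))).
Arguments upd {n} x i y _.
Arguments Rres p {n d} A beta gw x k i _.

(* Main.v *)
From mathcomp Require Import Rstruct.
Require Import Defs.
From Stdlib Require Import Reals Lra Psatz ClassicalEpsilon FunctionalExtensionality.
From mathcomp Require all_boot all_order all_algebra.
From mathcomp Require boolp classical_sets functions reals topology normedtype derive.
From mathcomp Require Import ssreflect ssrfun ssrbool eqtype ssrnat seq fintype bigop.
Set Implicit Arguments.
Unset Strict Implicit.

(** The iterates are controlled through the energy
    E_k = L_beta(x^k, lam^k) + sum_(i<p) m_i/4 |dx_i^k|^2 + m_p/(4 M_p^2) |dw^k|^2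
          + c |A_p^* dlam^k|^2,   c = tau / ((1 - tau) sigma theta beta),  tau = |theta - 1|.
    The block minimality conditions make L_beta(., lam) decrease by the m_i/2 |dx_i|^2 up to the
    Jacobi cross terms; the multiplier step costs |dlam|^2 / (theta beta).  As dlam lies in Im A_p,
    sigma |dlam|^2 <= |A_p^* dlam|^2, and optimality in the last block expresses A_p^* lamhat^k
    through grad f_p and the dx, dw, so that A_p^* dlam^{k+1} = (1 - theta) A_p^* dlam^k + theta u
    with u of the size of two successive increments.  Convexity of |.|^2 turns this recursion into
    a telescoping term plus theta gamma_theta |u|^2, and the conditions delta_i > 0 say exactly
    that E_{k+1} + D_k <= E_k for a sum D_k of squared increments.  Moreover
    L_beta(x^k, lam^k) - v(beta) >= (|lam^k|^2 - |lam^{k-1}|^2) / (2 theta beta), which telescopes;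
    hence the nonincreasing E_k can never fall below v(beta), and E_0 - v(beta) is Delta L_0.
    Averaging D_k + delta_lam |dlam^{k+1}|^2 over k yields the index j. *)

(** * Minima on the unit sphere of a row space *)

Module RowSpaceSphere.
Import all_boot all_order all_algebra boolp classical_sets functions reals topology normedtype derive.
Import Order.TTheory GRing.Theory Num.Theory numFieldNormedType.Exports.
Local Open Scope classical_set_scope.
Local Open Scope ring_scope.

Definition sqn (R : realType) n (u : 'rV[R]_n) : R := \sum_i (u 0 i) ^+ 2.

Lemma continuous_sumr (R : realType) (T : topologicalType) (I : Type) (r : seq I) (F : I -> T -> R) :
  (forall i, continuous (F i)) -> continuous (fun u => \sum_(i <- r) F i u).
Proof.
move=> cF; elim: r => [|i r IHr] u.
  by under eq_fun do rewrite big_nil; exact: cvg_cst.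
under eq_fun do rewrite big_cons.
by apply: cvgD; [exact: cF | exact: IHr].
Qed.

Lemma continuous_mulmx (R : realType) n q (B : 'M[R]_(n, q)) j :
  continuous (fun u : 'rV[R]_n => (u *m B) 0 j).
Proof.
have -> : (fun u : 'rV[R]_n => (u *m B) 0 j) = (fun u => \sum_i (u 0 i * B i j)).
  by apply: funext => u; rewrite mxE.
apply: continuous_sumr => i u; apply: (@continuousM _ _ (fun u : 'rV_n => u 0 i) (fun=> B i j));
  last exact: cst_continuous.
exact: coord_continuous.
Qed.

Lemma continuous_sqn_mulmx (R : realType) n q (B : 'M[R]_(n, q)) :
  continuous (fun u : 'rV[R]_n => sqn (u *m B)).
Proof.
rewrite /sqn; apply: continuous_sumr => i.
have -> : (fun u : 'rV[R]_n => (u *m B) 0 i ^+ 2) =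
          (fun u : 'rV[R]_n => (u *m B) 0 i) \* (fun u => (u *m B) 0 i).
  by apply: funext => u; rewrite expr2.
by move=> u; apply: continuousM; exact: continuous_mulmx.
Qed.

(** The sphere cut out of the row space is closed and bounded, hence compact, and a continuous
    function attains its minimum there. The premise supplies nonemptiness, which fails when [A] is
    zero. *)
Lemma min_on_row_space_sphere (R : realType) k n q (A : 'M[R]_(k, n)) (B : 'M[R]_(n, q)) :
  (exists2 u, (u <= A)%MS & sqn u = 1) ->
  exists u0, [/\ (u0 <= A)%MS, sqn u0 = 1 &
    forall u, (u <= A)%MS -> sqn u = 1 -> sqn (u0 *m B) <= sqn (u *m B)].
Proof.
move=> [u1 u1A u11].
pose K : set 'rV[R]_n := [set u | (u <= A)%MS /\ sqn u = 1].
(* The row space of A is the kernel of [cokermx A], hence closed. *)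
have KE : K = ((fun u => sqn (u *m cokermx A)) @^-1` [set 0]) `&`
              ((fun u => sqn (u *m 1%:M)) @^-1` [set 1]).
  rewrite /K; apply/seteqP; split => u /=; rewrite mulmx1 submxE.
    by move=> [/eqP -> ->]; split=> //; rewrite /sqn big1 // => i _; rewrite mxE expr0n.
  move=> [u0 ->]; split=> //; apply/eqP/rowP => i; rewrite [RHS]mxE; apply/eqP.
  move/eqP: u0; rewrite /sqn psumr_eq0 => [/allP/(_ i)|j _]; last exact: sqr_ge0.
  by rewrite mem_index_enum /= sqrf_eq0 => /(_ isT).
have Kcl : closed K.
  rewrite KE; apply: closedI.
    by apply: (preimage_closed _ (@closed_eq _ 0)) => u _; exact: continuous_sqn_mulmx.
  by apply: (preimage_closed _ (@closed_eq _ 1)) => u _; exact: continuous_sqn_mulmx.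
(* The norm on row vectors is the largest absolute entry, and the square of each entry is at most
   [sqn u = 1]. *)
have Kb : bounded_set K.
  exists 1; split=> // M M1 u [_ u1'] /=.
  rewrite /Num.norm /= mx_normrE; apply/bigmax_leP; split=> [|[i j] _ /=].
    by rewrite ltW // (lt_trans ltr01).
  apply: le_trans (ltW M1); rewrite -(@ler_pXn2r _ 2) ?nnegrE // expr1n -u1' /sqn.
  rewrite (bigD1 j) //= (ord1 i) real_normK ?num_real // lerDl.
  by apply: sumr_ge0 => l _; exact: sqr_ge0.
have [||u0 u0K u0min] := @EVT_min_rV R n (fun u => sqn (u *m B)) K _ (bounded_closed_compact Kb Kcl).
- by exists u1.
- by apply: continuous_subspaceT => u; exact: continuous_sqn_mulmx.
move: (u0K); rewrite inE => -[u0A u01]; exists u0; split=> // u uA u1'.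
by apply: u0min; rewrite inE.
Qed.
End RowSpaceSphere.

Local Open Scope R_scope.

(** * Finite sums, inner products and operator norms *)

Lemma pickR_spec (P : R -> Prop) : (exists r, P r) -> P (pickR P).
Proof.
rewrite /pickR; case: excluded_middle_informative => // h _.
by case: constructive_indefinite_description.
Qed.

Lemma bsum_le (I : finType) (P : pred I) (F G : I -> R) :
  (forall i, P i -> F i <= G i) ->
  \big[Rplus/0]_(i | P i) F i <= \big[Rplus/0]_(i | P i) G i.
Proof.
by move=> h; elim/big_ind2: _ => //; [lra | move=> *; exact: Rplus_le_compat].
Qed.

Lemma bsum_ge0 (I : finType) (P : pred I) (F : I -> R) :
  (forall i, P i -> 0 <= F i) -> 0 <= \big[Rplus/0]_(i | P i) F i.
Proof. by move=> h; elim/big_ind: _ => //; [lra | move=> *; lra]. Qed.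

Lemma bsumZ (I : finType) (P : pred I) (c : R) (F : I -> R) :
  \big[Rplus/0]_(i | P i) (c * F i) = c * \big[Rplus/0]_(i | P i) F i.
Proof. by rewrite big_distrr. Qed.

Lemma bsumD (I : finType) (P : pred I) (F G : I -> R) :
  \big[Rplus/0]_(i | P i) (F i + G i) =
  \big[Rplus/0]_(i | P i) F i + \big[Rplus/0]_(i | P i) G i.
Proof. by rewrite big_split. Qed.

Lemma bsumB (I : finType) (P : pred I) (F G : I -> R) :
  \big[Rplus/0]_(i | P i) (F i - G i) =
  \big[Rplus/0]_(i | P i) F i - \big[Rplus/0]_(i | P i) G i.
Proof. by elim/big_ind3: _ => //; [lra | move=> *; lra]. Qed.

Lemma bsum_ge_term (I : finType) (P : pred I) (F : I -> R) (j : I) :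
  P j -> (forall i, P i -> 0 <= F i) -> F j <= \big[Rplus/0]_(i | P i) F i.
Proof.
move=> Pj F0; rewrite (bigD1 j) //=.
suff : 0 <= \big[Rplus/0]_(i | P i && (i != j)) F i by lra.
by apply: bsum_ge0 => i /andP[/F0].
Qed.

Lemma dotC n (u v : vec n) : dot u v = dot v u.
Proof. by apply: eq_bigr => t _; rewrite Rmult_comm. Qed.

Lemma dotDl n (u v w : vec n) : dot (vadd u v) w = dot u w + dot v w.
Proof. by rewrite /dot -bsumD; apply: eq_bigr => t _; rewrite /vadd; ring. Qed.

Lemma dotBl n (u v w : vec n) : dot (vsub u v) w = dot u w - dot v w.
Proof. by rewrite /dot -bsumB; apply: eq_bigr => t _; rewrite /vsub; ring. Qed.

Lemma dotZl n c (u w : vec n) : dot (vscal c u) w = c * dot u w.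
Proof. by rewrite /dot -bsumZ; apply: eq_bigr => t _; rewrite /vscal; ring. Qed.

Lemma dotDr n (u v w : vec n) : dot w (vadd u v) = dot w u + dot w v.
Proof. by rewrite dotC dotDl !(dotC w). Qed.

Lemma dotBr n (u v w : vec n) : dot w (vsub u v) = dot w u - dot w v.
Proof. by rewrite dotC dotBl !(dotC w). Qed.

Lemma dotZr n c (u w : vec n) : dot w (vscal c u) = c * dot w u.
Proof. by rewrite dotC dotZl (dotC w). Qed.

Lemma dot_sumr (I : finType) (P : pred I) n (u : vec n) (F : I -> vec n) :
  dot u (fun t => \big[Rplus/0]_(i | P i) F i t) = \big[Rplus/0]_(i | P i) dot u (F i).
Proof.
rewrite /dot exchange_big /=; apply: eq_bigr => t _.
by rewrite -bsumZ.
Qed.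

Definition dotE := (dotBl, dotBr, dotDl, dotDr, dotZl, dotZr).

Lemma dot0l n (v : vec n) : dot (@vzero n) v = 0.
Proof. by rewrite /dot big1 // => t _; rewrite /vzero; ring. Qed.

Lemma dot_ge0 n (u : vec n) : 0 <= dot u u.
Proof. by apply: bsum_ge0 => t _; nra. Qed.

Lemma dot_eq0 n (u : vec n) : dot u u = 0 -> u = @vzero n.
Proof.
move=> u0; apply: functional_extensionality => t; rewrite /vzero.
have h : u t * u t <= dot u u by apply: (bsum_ge_term (F := fun t => u t * u t)) => // i _; nra.
nra.
Qed.

Lemma vnorm_ge0 n (u : vec n) : 0 <= vnorm u.
Proof. exact: sqrt_pos. Qed.

Lemma vnorm_sq n (u : vec n) : vnorm u ^ 2 = dot u u.
Proof. by rewrite /vnorm pow2_sqrt //; exact: dot_ge0. Qed.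

Lemma vnorm_le n (u : vec n) c : 0 <= c -> dot u u <= c ^ 2 -> vnorm u <= c.
Proof. by move=> c0 h; rewrite -(sqrt_pow2 c c0); exact: sqrt_le_1_alt. Qed.

Lemma vnorm_zero n : vnorm (@vzero n) = 0.
Proof. by rewrite /vnorm dot0l sqrt_0. Qed.

Lemma cauchy_schwarz n (u v : vec n) : dot u v <= vnorm u * vnorm v.
Proof.
have := vnorm_sq u; have := vnorm_sq v; have := vnorm_ge0 u; have := vnorm_ge0 v.
set a := vnorm u; set b := vnorm v => b0 a0 hb ha.
(* Expanding |b u - a v|^2 >= 0 leaves twice this product; dividing by [a * b] requires both norms
   to be nonzero. *)
have h : 0 <= a * b * (a * b - dot u v).
  have := dot_ge0 (vsub (vscal b u) (vscal a v)).
  by rewrite !dotE -hb -ha (dotC v u); nra.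
case: (Req_dec a 0) => ha0.
  by rewrite (@dot_eq0 _ u) -?ha ?ha0 ?dot0l; nra.
case: (Req_dec b 0) => hb0.
  by rewrite dotC (@dot_eq0 _ v) -?hb ?hb0 ?dot0l; nra.
have ab : 0 < a * b by nra.
nra.
Qed.

Lemma vnorm_scal n c (u : vec n) : vnorm (vscal c u) = Rabs c * vnorm u.
Proof.
rewrite /vnorm !dotE -Rmult_assoc sqrt_mult_alt; last by nra.
by rewrite -[c * c]/(Rsqr c) sqrt_Rsqr_abs.
Qed.

Lemma vnorm_add n (u v : vec n) : vnorm (vadd u v) <= vnorm u + vnorm v.
Proof.
have := vnorm_ge0 u; have := vnorm_ge0 v; have := cauchy_schwarz u v => h hv hu.
apply: vnorm_le; first lra.
by rewrite !dotE (dotC v u); have := vnorm_sq u; have := vnorm_sq v; nra.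
Qed.

Lemma vsub_diag n (u : vec n) : vsub u u = @vzero n.
Proof. by apply: functional_extensionality => t; rewrite /vsub /vzero; ring. Qed.

(** Pairing the sum S with itself gives |S|^2 = sum <S, F i> <= |S| sum |F i|, and |S| cancels
    unless it is zero. *)
Lemma vnorm_sum (I : finType) (P : pred I) n (F : I -> vec n) :
  vnorm (fun t => \big[Rplus/0]_(i | P i) F i t) <= \big[Rplus/0]_(i | P i) vnorm (F i).
Proof.
set S := fun t => _.
have := vnorm_ge0 S; have := vnorm_sq S.
rewrite {2}/S dot_sumr => hS S0.
have : \big[Rplus/0]_(i | P i) dot S (F i) <=
       \big[Rplus/0]_(i | P i) (vnorm S * vnorm (F i)).
  by apply: bsum_le => i _; exact: cauchy_schwarz.
rewrite bsumZ -hS => h.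
case: (Req_dec (vnorm S) 0) => h0; last by nra.
by rewrite h0; apply: bsum_ge0 => i _; exact: vnorm_ge0.
Qed.

Lemma mapplyE d n (A : mat d n) x r : mapply A x r = dot (A r) x.
Proof. by []. Qed.

Lemma mapplyD d n (A : mat d n) x y : mapply A (vadd x y) = vadd (mapply A x) (mapply A y).
Proof. by apply: functional_extensionality => r; rewrite /vadd !mapplyE dotDr. Qed.

Lemma mapplyB d n (A : mat d n) x y : mapply A (vsub x y) = vsub (mapply A x) (mapply A y).
Proof. by apply: functional_extensionality => r; rewrite /vsub !mapplyE dotBr. Qed.

Lemma mapplyZ d n (A : mat d n) c x : mapply A (vscal c x) = vscal c (mapply A x).
Proof. by apply: functional_extensionality => r; rewrite /vscal !mapplyE dotZr. Qed.

Lemma mapply0 d n (A : mat d n) : mapply A (@vzero n) = @vzero d.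
Proof. by apply: functional_extensionality => r; rewrite mapplyE dotC dot0l. Qed.

Lemma mapply_sum (I : finType) (P : pred I) d n (A : mat d n) (F : I -> vec n) :
  mapply A (fun t => \big[Rplus/0]_(i | P i) F i t) =
  (fun t => \big[Rplus/0]_(i | P i) mapply A (F i) t).
Proof. by apply: functional_extensionality => r; rewrite mapplyE dot_sumr. Qed.

Lemma dot_mapplyl d n (A : mat d n) x y : dot (mapply A x) y = dot x (mapply (mT A) y).
Proof.
rewrite /dot /mapply /mT.
under eq_bigr => r _ do rewrite Rmult_comm -bsumZ.
under [RHS]eq_bigr => r _ do rewrite -bsumZ.
by rewrite exchange_big; apply: eq_bigr => i _; apply: eq_bigr => j _; ring.
Qed.

Lemma dot_mapplyr d n (A : mat d n) x y : dot y (mapply A x) = dot (mapply (mT A) y) x.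
Proof. by rewrite dotC dot_mapplyl dotC. Qed.

Lemma mapply_mmul a b c (A : mat a b) (B : mat b c) x :
  mapply (mmul A B) x = mapply A (mapply B x).
Proof.
apply: functional_extensionality => r; rewrite /mapply /mmul.
under eq_bigr => i _ do rewrite Rmult_comm -bsumZ.
under [RHS]eq_bigr => i _ do rewrite -bsumZ.
by rewrite exchange_big; apply: eq_bigr => i _; apply: eq_bigr => j _; ring.
Qed.

(** The constant is the Frobenius norm, by Cauchy-Schwarz on each row, used for both signs so that
    the square is controlled. *)
Lemma mapply_bounded d n (A : mat d n) :
  exists2 C, 0 <= C & forall x, vnorm (mapply A x) <= C * vnorm x.
Proof.
pose S := \big[Rplus/0]_(r < d) dot (A r) (A r).
have S0 : 0 <= S by apply: bsum_ge0 => r _; exact: dot_ge0.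
exists (sqrt S); first exact: sqrt_pos.
move=> x; have := vnorm_ge0 x; have := sqrt_pos S => h1 h2.
apply: vnorm_le; first by nra.
rewrite Rpow_mult_distr pow2_sqrt // vnorm_sq Rmult_comm -bsumZ.
apply: bsum_le => r _; rewrite !mapplyE.
have := cauchy_schwarz (A r) x; have := cauchy_schwarz (vscal (-1) (A r)) x.
rewrite vnorm_scal dotE Rabs_Ropp Rabs_R1 -!vnorm_sq => h3 h4.
have := vnorm_ge0 (A r); nra.
Qed.

(** [opnorm] is a chosen real with default 0, so the supremum must first be shown to exist.
    Homogeneity and boundedness suffice for the estimate, which therefore covers matrices and
    products of matrices alike. *)
Lemma opnorm_bound m n (F : vec m -> vec n) :
  (forall c x, F (vscal c x) = vscal c (F x)) ->
  (exists2 C, 0 <= C & forall x, vnorm (F x) <= C * vnorm x) ->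
  0 <= opnorm F /\ forall x, vnorm (F x) <= opnorm F * vnorm x.
Proof.
move=> FZ [C C0 FC]; set E := fun r => exists x, vnorm x <= 1 /\ r = vnorm (F x).
have [ub _] : is_lub E (opnorm F).
  apply: pickR_spec; case: (completeness E) => [||l hl]; last by exists l.
    by exists C => r [x [x1 ->]]; have := FC x; have := vnorm_ge0 x; nra.
  by exists (vnorm (F (@vzero m))), (@vzero m); rewrite vnorm_zero; split=> //; lra.
have F0 : 0 <= opnorm F.
  apply: (Rle_trans _ (vnorm (F (@vzero m)))); first exact: vnorm_ge0.
  by apply: ub; exists (@vzero m); rewrite vnorm_zero; split=> //; lra.
split=> // x; case: (Req_dec (vnorm x) 0) => hx.
  by have := FC x; rewrite hx; lra.
have x0 : 0 < vnorm x by have := vnorm_ge0 x; lra.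
have := ub (vnorm (F (vscal (/ vnorm x) x))); rewrite FZ !vnorm_scal.
rewrite Rabs_right; last by apply/Rle_ge/Rlt_le/Rinv_0_lt_compat.
move=> h; have {}h : / vnorm x * vnorm (F x) <= opnorm F.
  apply: h; exists (vscal (/ vnorm x) x); rewrite FZ !vnorm_scal.
  rewrite Rabs_right; last by apply/Rle_ge/Rlt_le/Rinv_0_lt_compat.
  by rewrite Rinv_l //; split=> //; lra.
apply: (Rmult_le_reg_l (/ vnorm x)); first exact: Rinv_0_lt_compat.
by have -> : / vnorm x * (opnorm F * vnorm x) = opnorm F by field.
Qed.

Lemma opnorm_mapply d n (A : mat d n) :
  0 <= opnorm (mapply A) /\ forall x, vnorm (mapply A x) <= opnorm (mapply A) * vnorm x.
Proof. exact: opnorm_bound (@mapplyZ _ _ A) (mapply_bounded A). Qed.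

Lemma opnorm_mapply2 a d n (B : mat a d) (A : mat d n) :
  0 <= opnorm (fun z => mapply B (mapply A z)) /\
  forall x, vnorm (mapply B (mapply A x)) <= opnorm (fun z => mapply B (mapply A z)) * vnorm x.
Proof.
apply: (opnorm_bound (F := fun z => mapply B (mapply A z))).
  by move=> c x; rewrite !mapplyZ.
have [C C0 hC] := mapply_bounded A; have [D D0 hD] := mapply_bounded B.
exists (D * C); first by nra.
by move=> x; have := hC x; have := hD (mapply A x); nra.
Qed.

(** * The smallest positive eigenvalue of [A^T A] *)

Module Bridge.
Import all_boot all_order all_algebra.
Import GRing.Theory.
Local Open Scope ring_scope.

Definition row_of_vec n (u : vec n) : 'rV[R]_n := \row_i u i.
Definition mx_of_mat d n (A : mat d n) : 'M[R]_(d, n) := \matrix_(i, j) A i j.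

Lemma sqn_row_of_vec n (u : vec n) : RowSpaceSphere.sqn (row_of_vec u) = dot u u.
Proof. by rewrite /RowSpaceSphere.sqn /dot; apply: eq_bigr => i _; rewrite mxE expr2. Qed.

Lemma row_of_vec_mapply d n (A : mat d n) z :
  row_of_vec (mapply A z) = row_of_vec z *m (mx_of_mat A)^T.
Proof. by apply/rowP => i; rewrite !mxE; apply: eq_bigr => j _; rewrite !mxE mulrC. Qed.

Lemma row_of_vec_surj n (u : 'rV[R]_n) : exists v, row_of_vec v = u.
Proof. by exists (fun i => u 0 i); apply/rowP => i; rewrite mxE. Qed.

Lemma row_of_vec_inj n (u v : vec n) : row_of_vec u = row_of_vec v -> u = v.
Proof.
move=> h; apply: functional_extensionality => i.
by have := congr1 (fun w : 'rV_n => w 0 i) h; rewrite !mxE.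
Qed.

(** Matrices act on columns in [mapply] but on rows in the row-space order, hence the transpose. *)
Lemma in_image d n (A : mat d n) u :
  (row_of_vec u <= (mx_of_mat A)^T)%MS <-> exists z, mapply A z = u.
Proof.
split=> [/submxP[D hD]|[z <-]]; last by rewrite row_of_vec_mapply submxMl.
have [z hz] := row_of_vec_surj D; exists z.
by apply: row_of_vec_inj; rewrite row_of_vec_mapply hz.
Qed.

Lemma min_on_image_sphere d n (A : mat d n) :
  (exists u, (exists z, mapply A z = u) /\ dot u u = 1) ->
  exists u0, [/\ exists z, mapply A z = u0, dot u0 u0 = 1 &
    forall u, (exists z, mapply A z = u) -> dot u u = 1 ->
      Rle (dot (mapply (mT A) u0) (mapply (mT A) u0)) (dot (mapply (mT A) u) (mapply (mT A) u))].
Proof.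
move=> [u [uA u1]].
have [|v [vA v1 vmin]] := @RowSpaceSphere.min_on_row_space_sphere _ _ _ _
  (mx_of_mat A)^T (mx_of_mat (mT A))^T.
  by exists (row_of_vec u); [exact/in_image | rewrite sqn_row_of_vec].
have [u0 hu0] := row_of_vec_surj v; rewrite -hu0 in vA v1 vmin.
exists u0; split; [exact/in_image | by rewrite -sqn_row_of_vec |].
move=> y yA y1; apply/RleP; have := vmin (row_of_vec y).
rewrite -!row_of_vec_mapply !sqn_row_of_vec; apply => //; exact/in_image.
Qed.
End Bridge.

(** First-order condition for a minimum at t = 0: with C = |c| + 1, the choice t = -a/C makes the
    expression at most -a^2/C. *)
Lemma linear_coef_eq0 a c : (forall t, 0 <= 2 * t * a + t ^ 2 * c) -> a = 0.
Proof.
move=> h; pose C := Rabs c + 1.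
have C0 : 0 < C by rewrite /C; have := Rabs_pos c; lra.
have cC : c <= C by rewrite /C; have := Rle_abs c; lra.
have := h (- a / C).
have -> : 2 * (- a / C) * a + (- a / C) ^ 2 * c = a ^ 2 * (/ C * (c / C - 2)) by field; lra.
have iC : 0 < / C by exact: Rinv_0_lt_compat.
have : c / C - 2 <= -1.
  have : c / C <= 1 by apply: (Rmult_le_reg_r C) => //; rewrite /Rdiv Rmult_assoc Rinv_l; lra.
  lra.
move=> h1 h2.
case: (Req_dec a 0) => // a0.
have a2 : 0 < a ^ 2 * / C by apply: Rmult_lt_0_compat => //; nra.
by move: h2; rewrite -Rmult_assoc; nra.
Qed.

(* Minimising |A^T u|^2 over the unit sphere of Im A gives an eigenvector u of A A^T, and A^T u
   is then an eigenvector of A^T A for its least positive eigenvalue. *)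
Lemma smallest_pos_eig_spec d n (A : mat d n) :
  (exists r c, A r c <> 0) ->
  let s := smallest_pos_eig (mmul (mT A) A) in
  0 < s /\ forall z, s * vnorm (mapply A z) ^ 2 <= vnorm (mapply (mT A) (mapply A z)) ^ 2.
Proof.
move=> [r [c Arc]] s.
have unit_scal k (v : vec k) : v <> @vzero k ->
    0 < dot v v /\ dot (vscal (/ vnorm v) v) (vscal (/ vnorm v) v) = 1.
  move=> v0; have vv : 0 < dot v v.
    case: (Rtotal_order 0 (dot v v)) => [|[/esym/dot_eq0|]] //.
    by have := dot_ge0 v; lra.
  split=> //; rewrite !dotE -vnorm_sq; field.
  by move=> h; rewrite -vnorm_sq h in vv; lra.
have [u0 [[z0 z0u] u01 umin]] : exists u0, [/\ exists z, mapply A z = u0, dot u0 u0 = 1 &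
    forall u, (exists z, mapply A z = u) -> dot u u = 1 ->
      dot (mapply (mT A) u0) (mapply (mT A) u0) <= dot (mapply (mT A) u) (mapply (mT A) u)].
  apply: Bridge.min_on_image_sphere.
  (* The basis vector at [c] has a nonzero image, so the unit sphere of Im A is not empty. *)
  pose z : vec n := fun t => if t == c then 1 else 0.
  have zA : mapply A z r = A r c.
    rewrite /mapply (bigD1 c) //= big1 => [|i /negbTE ic]; rewrite /z ?eqxx ?ic; ring.
  have nz : mapply A z <> @vzero d by move=> h; rewrite h /vzero in zA; case: Arc.
  have [_ h] := unit_scal _ _ nz.
  exists (vscal (/ vnorm (mapply A z)) (mapply A z)); split=> //.
  by exists (vscal (/ vnorm (mapply A z)) z); rewrite mapplyZ.
set mu := dot _ _ in umin.
(* Both sides are homogeneous of degree two, so minimality on the unit sphere extends to all of Im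
   A. *)
have qmu z : mu * dot (mapply A z) (mapply A z) <=
    dot (mapply (mT A) (mapply A z)) (mapply (mT A) (mapply A z)).
  case: (excluded_middle_informative (mapply A z = @vzero d)) => [->|nz].
    by rewrite mapply0 !dot0l; lra.
  have [pos h] := unit_scal _ _ nz.
  have := umin (vscal (/ vnorm (mapply A z)) (mapply A z)).
  rewrite mapplyZ h => /(_ (ex_intro _ (vscal (/ vnorm (mapply A z)) z) (mapplyZ _ _ _)) erefl).
  rewrite !dotE => h2.
  have vn : vnorm (mapply A z) ^ 2 * (/ vnorm (mapply A z)) ^ 2 = 1.
    by rewrite -Rpow_mult_distr Rinv_r ?pow1 // => h0; have := vnorm_sq (mapply A z); rewrite h0; lra.
  rewrite -(vnorm_sq (mapply A z)) in pos *.
  have : mu * vnorm (mapply A z) ^ 2 <= vnorm (mapply A z) ^ 2 * ((/ vnorm (mapply A z)) ^ 2 *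
    dot (mapply (mT A) (mapply A z)) (mapply (mT A) (mapply A z))) by nra.
  by rewrite -Rmult_assoc vn; lra.
(* [qmu] is an equality at [z0]; along z0 + t z its gap is a nonnegative quadratic in t with no
   constant term, so the linear coefficient vanishes. *)
have stat z : dot (mapply (mT A) u0) (mapply (mT A) (mapply A z)) = mu * dot u0 (mapply A z).
  apply: Rminus_diag_uniq; apply: (linear_coef_eq0 (c := dot (mapply (mT A) (mapply A z))
     (mapply (mT A) (mapply A z)) - mu * dot (mapply A z) (mapply A z))) => t.
  have := qmu (vadd z0 (vscal t z)).
  rewrite !(mapplyD, mapplyZ) z0u !dotE u01 -/mu (dotC (mapply A z) u0).
  rewrite (dotC (mapply (mT A) (mapply A z)) (mapply (mT A) u0)); nra.
(* The difference of the two sides lies in Im A, while [stat] makes it orthogonal to Im A. *)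
have eigu : mapply A (mapply (mT A) u0) = vscal mu u0.
  set w := mapply (mT A) u0.
  have wE : vsub (mapply A w) (vscal mu u0) = mapply A (vsub w (vscal mu z0)).
    by rewrite mapplyB mapplyZ z0u.
  have : dot (vsub (mapply A w) (vscal mu u0)) (vsub (mapply A w) (vscal mu u0)) = 0.
    rewrite {2}wE dotBl dotZl.
    by rewrite dot_mapplyl stat; lra.
  move/dot_eq0 => h; apply: functional_extensionality => i.
  by have := congr1 (fun f => f i) h; rewrite /vsub /vzero; lra.
have u0nz : mapply (mT A) u0 <> @vzero n.
  by move=> h; move: u01; rewrite -{1}z0u dot_mapplyl h dotC dot0l; lra.
have [mu0 _] := unit_scal _ _ u0nz; rewrite -/mu in mu0.
have eigmu : is_eig (mmul (mT A) A) mu.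
  by exists (mapply (mT A) u0); split=> //; rewrite mapply_mmul eigu mapplyZ.
(* For an eigenvector v, |A v|^2 = mu' |v|^2 and |A^T A v|^2 = mu'^2 |v|^2, so [qmu] at v compares
   [mu] with [mu']. *)
have least mu' : 0 < mu' -> is_eig (mmul (mT A) A) mu' -> mu <= mu'.
  move=> mu'0 [v [/unit_scal[v0 _]]]; rewrite mapply_mmul => hv.
  have := qmu v; rewrite dot_mapplyl hv !dotE => h.
  have : 0 < mu' * dot v v by nra.
  nra.
have [s0 [_ smin]] : 0 < s /\ is_eig (mmul (mT A) A) s /\
    forall mu', 0 < mu' -> is_eig (mmul (mT A) A) mu' -> s <= mu'.
  apply: (pickR_spec (P := fun s => 0 < s /\ is_eig (mmul (mT A) A) s /\
    forall mu', 0 < mu' -> is_eig (mmul (mT A) A) mu' -> s <= mu')).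
  by exists mu.
split=> // z; rewrite !vnorm_sq.
have := smin _ mu0 eigmu; have := qmu z; have := dot_ge0 (mapply A z); nra.
Qed.

(** * Block updates and subdifferentials *)

Lemma upd_same (n : nat -> nat) (x : forall j, vec (n j)) i (y : vec (n i)) : upd x i y i = y.
Proof.
rewrite /upd; case: PeanoNat.Nat.eq_dec => // e.
by rewrite (eq_irrelevance e erefl).
Qed.

Lemma upd_other (n : nat -> nat) (x : forall j, vec (n j)) i (y : vec (n i)) j :
  i <> j -> upd x i y j = x j.
Proof. by rewrite /upd; case: PeanoNat.Nat.eq_dec. Qed.

Lemma bsum_upd p (n : nat -> nat) (F : forall j, vec (n j) -> R) (x : forall j, vec (n j)) i
    (y : vec (n i)) : (i < p)%N ->
  \big[Rplus/0]_(j < p) F j (upd x i y j) =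
  \big[Rplus/0]_(j < p) F j (x j) + (F i y - F i (x i)).
Proof.
move=> ip; rewrite (bigD1 (Ordinal ip)) //= [X in _ = X + _](bigD1 (Ordinal ip)) //= upd_same.
under eq_bigr => j ji.
  rewrite upd_other; last by move=> h; case/eqP: ji; apply: val_inj.
  over.
by set S := bigop _ _ _; lra.
Qed.

Lemma big_oadd_some (I : finType) (F : I -> option R) : (forall i, F i <> None) ->
  \big[oadd/Some 0]_i F i = Some (\big[Rplus/0]_i rv (F i)).
Proof.
move=> h; elim/big_ind2: _ => //; first by move=> a b c d -> ->.
by move=> i _; have := h i; case: (F i).
Qed.

Lemma big_oadd_neq_none (I : finType) (F : I -> option R) :
  \big[oadd/Some 0]_i F i <> None -> forall i, F i <> None.
Proof.
move=> h i; have := mem_index_enum i; elim: (index_enum I) h => // j r IHr.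
rewrite big_cons inE => h /orP[/eqP-> Fj|/IHr]; first by rewrite Fj in h.
by apply; move=> h0; apply: h; rewrite h0; case: (F j).
Qed.

Section Blocks.
Context (p : nat) (n : nat -> nat) (d : nat) (A : forall i, mat d (n i)) (b : vec d)
  (f : forall i, vec (n i) -> option R) (beta : R).

Arguments A : clear implicits.
Arguments f : clear implicits.

Definition blocks_dom (x : forall i, vec (n i)) := forall i, (i < p)%N -> dom (f i) (x i).

(** Agrees with [Lag] on [blocks_dom]; elsewhere [rv] replaces infinite values by 0. *)
Definition real_Lag (x : forall i, vec (n i)) (lam : vec d) : R :=
  \big[Rplus/0]_(i < p) rv (f i (x i)) - dot lam (resid p A b x)
  + beta / 2 * vnorm (resid p A b x) ^ 2.

Lemma fsum_dom x : blocks_dom x -> fsum p f x = Some (\big[Rplus/0]_(i < p) rv (f i (x i))).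
Proof. by move=> h; apply: (big_oadd_some (F := fun i : 'I_p => f i (x i))) => i; exact: h. Qed.

Lemma Lag_dom x lam : blocks_dom x -> Lag p A b f beta x lam = Some (real_Lag x lam).
Proof. by move=> /fsum_dom; rewrite /Lag => ->; rewrite /oadd /real_Lag /Rminus Rplus_assoc. Qed.

Lemma dom_of_Lag x lam : Lag p A b f beta x lam <> None -> blocks_dom x.
Proof.
rewrite /Lag /fsum => h i ip.
have h' : \big[oadd/Some 0]_(j < p) f j (x j) <> None by move=> h0; rewrite h0 in h.
exact: (@big_oadd_neq_none _ (fun j : 'I_p => f j (x j)) h' (Ordinal ip)).
Qed.

Lemma blocks_dom_upd x i (y : vec (n i)) :
  blocks_dom x -> dom (f i) y -> blocks_dom (upd x i y).
Proof.
move=> xd yd j jp; case: (PeanoNat.Nat.eq_dec i j) => [e|ne]; last by rewrite upd_other //; exact: xd.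
by case: j / e jp => _; rewrite upd_same.
Qed.

Lemma resid_upd x i (y : vec (n i)) : (i < p)%N ->
  resid p A b (upd x i y) = vadd (resid p A b x) (mapply (A i) (vsub y (x i))).
Proof.
move=> ip; apply: functional_extensionality => r.
rewrite /resid /vadd (bsum_upd (fun j u => mapply (A j) u r) x y ip) mapplyB /vsub; lra.
Qed.

Lemma resid_sub x x' : resid p A b x' =
  vadd (resid p A b x) (fun t => \big[Rplus/0]_(j < p) mapply (A j) (vsub (x' j) (x j)) t).
Proof.
apply: functional_extensionality => r; rewrite /resid /vadd.
under [X in _ = _ + X]eq_bigr => j _ do rewrite mapplyB /vsub.
rewrite bsumB /=; lra.
Qed.

(** The exact change of the multiplier and penalty terms when block [i] moves to [y] and the other
    blocks stay frozen. *)
Definition quad_part (x : forall i, vec (n i)) (lam : vec d) i (y : vec (n i)) : R :=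
  dot (vsub (vscal beta (resid p A b x)) lam) (mapply (A i) (vsub y (x i)))
  + beta / 2 * dot (mapply (A i) (vsub y (x i))) (mapply (A i) (vsub y (x i))).

Lemma real_Lag_upd x lam i (y : vec (n i)) : (i < p)%N ->
  real_Lag (upd x i y) lam =
  real_Lag x lam + (rv (f i y) - rv (f i (x i)) + quad_part x lam y).
Proof.
move=> ip; rewrite /real_Lag (bsum_upd (fun j u => rv (f j u)) x y ip) resid_upd //.
rewrite /quad_part; move: (resid p A b x) (mapply _ _) => r u.
rewrite !vnorm_sq !dotE (dotC u r); lra.
Qed.

(** Comparison with the old block [x i], where the objective is finite, forces the minimiser into
    the domain; the terms that do not depend on block [i] then cancel. *)
Lemma block_min x lam i w gw (ys : vec (n i)) : (i < p)%N -> blocks_dom x ->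
  (forall y : vec (n i),
     ele (oadd (Lag p A b f beta (upd x i ys) lam) (Some (breg w gw (x i) ys)))
         (oadd (Lag p A b f beta (upd x i y) lam) (Some (breg w gw (x i) y)))) ->
  dom (f i) ys /\
  forall y, dom (f i) y ->
    rv (f i ys) + (quad_part x lam ys + breg w gw (x i) ys) <=
    rv (f i y) + (quad_part x lam y + breg w gw (x i) y).
Proof.
move=> ip xd h.
have ysd : dom (f i) ys.
  have := h (x i); rewrite (Lag_dom _ (blocks_dom_upd xd (xd _ ip))).
  move E : (Lag _ _ _ _ _ (upd x i ys) _) => [l|] //= _.
  have /dom_of_Lag/(_ i ip) : Lag p A b f beta (upd x i ys) lam <> None by rewrite E.
  by rewrite upd_same.
split=> // y yd; have := h y.
by rewrite !Lag_dom ?real_Lag_upd //=; [lra | exact: blocks_dom_upd..].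
Qed.
End Blocks.

Lemma has_gradD n (h1 h2 : vec n -> R) x g1 g2 :
  has_grad h1 x g1 -> has_grad h2 x g2 -> has_grad (fun y => h1 y + h2 y) x (vadd g1 g2).
Proof.
move=> H1 H2 eps e0.
have [|d1 [d10 hd1]] := H1 (eps / 2); first lra.
have [|d2 [d20 hd2]] := H2 (eps / 2); first lra.
exists (Rmin d1 d2); split; first exact: Rmin_pos.
move=> y hy; rewrite dotDl.
have := hd1 y (Rlt_le_trans _ _ _ hy (Rmin_l _ _)).
have := hd2 y (Rlt_le_trans _ _ _ hy (Rmin_r _ _)).
set a := h1 y - _ - _; set c := h2 y - _ - _ => ? ?.
have -> : h1 y + h2 y - (h1 x + h2 x) - (dot g1 (vsub y x) + dot g2 (vsub y x)) = a + c.
  by rewrite /a /c; ring.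
have := Rabs_triang a c; lra.
Qed.

Lemma has_grad_quadratic n (h : vec n -> R) x g C :
  (forall y, Rabs (h y - h x - dot g (vsub y x)) <= C * vnorm (vsub y x) ^ 2) -> has_grad h x g.
Proof.
move=> hq eps e0; pose K := Rabs C + 1.
have K0 : 0 < K by rewrite /K; have := Rabs_pos C; lra.
exists (eps / K); split; first exact: Rdiv_lt_0_compat.
move=> y hy; apply: Rle_trans (hq y) _.
have v0 := vnorm_ge0 (vsub y x).
have hK : K * vnorm (vsub y x) <= eps.
  apply: Rlt_le; apply: (Rmult_lt_reg_r (/ K)); first exact: Rinv_0_lt_compat.
  by have -> : K * vnorm (vsub y x) * / K = vnorm (vsub y x) by field; lra.
have : C <= K by rewrite /K; have := Rle_abs C; lra.
nra.
Qed.

Lemma breg_has_grad n (w : vec n -> R) gw z x :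
  has_grad w x (gw x) -> has_grad (breg w gw z) x (vsub (gw x) (gw z)).
Proof.
move=> hw eps e0; have [del [d0 hdel]] := hw _ e0; exists del; split=> // y hy.
have := hdel y hy; congr (Rabs _ <= _).
have -> : vsub y x = vsub (vsub y z) (vsub x z).
  by apply: functional_extensionality => t; rewrite /vsub; ring.
by rewrite /breg !dotE; ring.
Qed.

Lemma Rabs_le_between a c : Rabs a <= c -> - c <= a <= c.
Proof. by split_Rabs; lra. Qed.

(** Fermat's rule: minimality gives f(y) - f(x) >= h(x) - h(y), and the expansion of h bounds the
    right side below. Points outside the domain satisfy the inequality trivially. *)
Lemma fermat_frechet n (f : vec n -> option R) (h : vec n -> R) x g :
  dom f x -> (forall y, dom f y -> rv (f x) + h x <= rv (f y) + h y) ->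
  has_grad h x g -> frechet_subdiff f x (vscal (-1) g).
Proof.
move=> xd xmin hg; split=> // eps e0; have [del [d0 hdel]] := hg _ e0.
exists del; split=> // y hy; move E : (f y) => [s|] //=.
have := xmin y; rewrite /dom E => /(_ ltac:(by [])) /=.
have := hdel y hy => /Rabs_le_between.
rewrite dotZl; lra.
Qed.

Lemma frechet_limiting n (f : vec n -> option R) x v :
  frechet_subdiff f x v -> limiting_subdiff f x v.
Proof.
move=> h; split; first by case: h.
exists (fun=> x), (fun=> v); split; last split; last split=> //.
- by move=> eps e0; exists 0%N => k _; rewrite vsub_diag vnorm_zero.
- by move=> eps e0; exists 0%N => k _; rewrite /Rdist Rminus_diag Rabs_R0; exact: e0.
- by move=> eps e0; exists 0%N => k _; rewrite vsub_diag vnorm_zero.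
Qed.

(** Moving from x along u = v - g by a small t > 0, the two expansions with error |u|/4 each give t
    |u|^2 <= t |u|^2 / 2, so u = 0. *)
Lemma frechet_differentiable n (f : vec n -> option R) x v g :
  (forall z, f z <> None) -> has_grad (fun y => rv (f y)) x g ->
  frechet_subdiff f x v -> v = g.
Proof.
move=> ffin hg [_ hv]; set u := vsub v g.
case: (Req_dec (dot u u) 0) => [/dot_eq0 h|nz].
  by apply: functional_extensionality => t; have := congr1 (fun k => k t) h; rewrite /u /vsub
    /vzero; lra.
have un : 0 < vnorm u.
  by have := vnorm_ge0 u; have := vnorm_sq u; case: (Req_dec (vnorm u) 0) => [->|]; lra.
have [|d1 [d10 hd1]] := hg (vnorm u / 4); first lra.
have [|d2 [d20 hd2]] := hv (vnorm u / 4); first lra.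
pose del := Rmin d1 d2; have del0 : 0 < del by exact: Rmin_pos.
pose t := del / (2 * vnorm u).
have t0 : 0 < t by apply: Rdiv_lt_0_compat; lra.
have tu : t * vnorm u = del / 2 by rewrite /t; field; lra.
pose y := vadd x (vscal t u).
have yx : vsub y x = vscal t u.
  by apply: functional_extensionality => i; rewrite /y /vsub /vadd; ring.
have nyx : vnorm (vsub y x) = t * vnorm u by rewrite yx vnorm_scal Rabs_right //; lra.
have := hd1 y; have := hd2 y; rewrite nyx tu yx.
have := ffin y; case: (f y) => // s _ /=.
have m1 := Rmin_l d1 d2; have m2 := Rmin_r d1 d2; rewrite -/del in m1 m2.
move=> /(_ ltac:(lra)) h2 /(_ ltac:(lra)) /Rabs_le_between h1.
have : dot v (vscal t u) - dot g (vscal t u) <= vnorm u / 2 * (t * vnorm u) by rewrite tu; lra.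
rewrite !dotZr.
have : dot u u = dot v u - dot g u by rewrite {1}/u dotBl.
rewrite -vnorm_sq; nra.
Qed.

(** * Scalar and vector inequalities *)

Lemma young n (u v : vec n) c : 0 < c -> 2 * dot u v <= dot u u / c + c * dot v v.
Proof.
move=> c0; have h := dot_ge0 (vsub u (vscal c v)).
have hE : dot (vsub u (vscal c v)) (vsub u (vscal c v)) =
    dot u u - 2 * c * dot u v + c * c * dot v v.
  by rewrite !(dotBl, dotBr, dotZl, dotZr) (dotC v u); ring.
rewrite hE in h; apply: (Rmult_le_reg_l c) => //.
have -> : c * (dot u u / c + c * dot v v) = dot u u + c * c * dot v v by field; lra.
lra.
Qed.

Lemma dot_bsum_le n (F : nat -> vec n) q :
  dot (fun t => \big[Rplus/0]_(i < q) F i t) (fun t => \big[Rplus/0]_(i < q) F i t) <=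
  INR q * \big[Rplus/0]_(i < q) dot (F i) (F i).
Proof.
elim: q => [|q IHq].
  by rewrite big_ord0 (_ : (fun _ => _) = @vzero n) ?dot0l /=; [lra |
    apply: functional_extensionality => t; rewrite big_ord0].
pose s : vec n := fun t => \big[Rplus/0]_(i < q) F i t.
have -> : (fun t => \big[Rplus/0]_(i < q.+1) F i t) = vadd s (F q).
  by apply: functional_extensionality => t; rewrite big_ord_recr.
rewrite big_ord_recr S_INR /=; rewrite -/s in IHq.
set T := \big[Rplus/0]_(i < q) _ in IHq *.
have T0 : 0 <= T by apply: bsum_ge0 => i _; exact: dot_ge0.
rewrite !(dotDl, dotDr) (dotC (F q) s); have Fq0 := dot_ge0 (F q).
have := pos_INR q; case=> [q0|q0]; last first.
  have s0 : s = @vzero n by apply: dot_eq0; have := dot_ge0 s; rewrite -q0 in IHq; lra.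
  by rewrite s0 -q0 !dot0l; lra.
have := young s (F q) q0.
have : dot s s / INR q <= T.
  apply: (Rmult_le_reg_r (INR q)) => //.
  have -> : dot s s / INR q * INR q = dot s s by field; lra.
  by lra.
nra.
Qed.

(** Cauchy-Schwarz for q + 2 vectors. With q = p - 1 this count is the factor p + 1 in the parameter
    conditions. *)
Lemma dot_add_bsum_le n (F : nat -> vec n) q (g h : vec n) : (0 < q)%N ->
  let s := fun t => \big[Rplus/0]_(i < q) F i t in
  dot (vadd (vadd g h) s) (vadd (vadd g h) s) <=
  (INR q + 2) * (dot g g + dot h h + \big[Rplus/0]_(i < q) dot (F i) (F i)).
Proof.
move=> q1 s; have q0 : 0 < INR q by apply: lt_0_INR; apply/ltP.
have hs := dot_bsum_le F q; rewrite -/s in hs.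
have young_s v : 2 * dot v s <= INR q * dot v v + \big[Rplus/0]_(i < q) dot (F i) (F i).
  have := young s v q0; rewrite (dotC s v).
  have : dot s s / INR q <= \big[Rplus/0]_(i < q) dot (F i) (F i).
    apply: (Rmult_le_reg_r (INR q)) => //.
    have -> : dot s s / INR q * INR q = dot s s by field; lra.
    by lra.
  lra.
have := young_s g; have := young_s h; have := young g h Rlt_0_1.
rewrite !(dotDl, dotDr) (dotC h g) (dotC s g) (dotC s h).
lra.

Qed.

(** Only the cross terms survive on the left. Those among the first [q] vectors cost q - 1; those
    with the last vector are split by Young's inequality with weight q / alpha, which is how [alpha]
    trades the last block against the others. *)
Lemma dot_bsum_offdiag_le n (F : nat -> vec n) q alpha : (0 < q)%N -> 0 < alpha ->
  dot (fun t => \big[Rplus/0]_(i < q.+1) F i t) (fun t => \big[Rplus/0]_(i < q.+1) F i t)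
    - \big[Rplus/0]_(i < q.+1) dot (F i) (F i) <=
  (INR q - 1 + alpha) * \big[Rplus/0]_(i < q) dot (F i) (F i) + INR q / alpha * dot (F q) (F q).
Proof.
move=> q1 a0; have q0 : 0 < INR q by apply: lt_0_INR; apply/ltP.
pose s : vec n := fun t => \big[Rplus/0]_(i < q) F i t.
have -> : (fun t => \big[Rplus/0]_(i < q.+1) F i t) = vadd s (F q).
  by apply: functional_extensionality => t; rewrite big_ord_recr.
rewrite big_ord_recr /=; have := dot_bsum_le F q; rewrite -/s.
set T := \big[Rplus/0]_(i < q) _ => hs.
have c0 : 0 < INR q / alpha by exact: Rdiv_lt_0_compat.
have := young s (F q) c0; rewrite !(dotDl, dotDr) (dotC (F q) s).
have : dot s s / (INR q / alpha) <= alpha * T.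
  have -> : dot s s / (INR q / alpha) = dot s s * (alpha / INR q) by field; lra.
  have -> : alpha * T = INR q * T * (alpha / INR q) by field; lra.
  by apply: Rmult_le_compat_r => //; apply/Rlt_le; exact: Rdiv_lt_0_compat.
lra.
Qed.

(** For tau > 0, v is the convex combination with weights tau and 1 - tau of (1 - theta) a / tau and
    theta u / (1 - tau). As |1 - theta| = tau, convexity gives |v|^2 <= tau |a|^2 + theta^2 |u|^2 /
    (1 - tau), which rearranges to the claim. *)
Lemma dual_recursion_bound n (a u : vec n) theta : 0 < theta < 2 ->
  let tau := Rabs (theta - 1) in
  let v := vadd (vscal (1 - theta) a) (vscal theta u) in
  dot v v <= tau / (1 - tau) * (dot a a - dot v v) + theta * gammaT theta * dot u u.
Proof.
move=> th tau v.
have t0 : 0 <= tau by exact: Rabs_pos.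
have t1 : 0 < 1 - tau by rewrite /tau; split_Rabs; lra.
have tt : (1 - theta) ^ 2 = tau ^ 2 by rewrite /tau pow2_abs; ring.
have vE : dot v v = (1 - theta) ^ 2 * dot a a + 2 * ((1 - theta) * theta * dot a u)
    + theta ^ 2 * dot u u.
  by rewrite /v !(dotDl, dotDr, dotZl, dotZr) (dotC u a); ring.
have key : (1 - tau) * dot v v <= tau * (1 - tau) * dot a a + theta ^ 2 * dot u u.
  have h := dot_ge0 (vsub (vscal (1 - tau) (vscal (1 - theta) a)) (vscal tau (vscal theta u))).
  rewrite !(dotBl, dotBr, dotZl, dotZr) (dotC u a) in h; rewrite vE.
  (* The convex combination divides by tau; when theta = 1 the term in [a] is absent. *)
  case: (Req_dec tau 0) => tau0.
    have -> : 1 - theta = 0 by nra.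
    by rewrite tau0; lra.
  have {}h : 0 <= (1 - tau) ^ 2 * ((1 - theta) ^ 2 * dot a a)
     - 2 * (1 - tau) * tau * ((1 - theta) * theta * dot a u) + tau ^ 2 * (theta ^ 2 * dot u u).
    by lra.
  rewrite tt in h.
  apply: (Rmult_le_reg_l tau); first lra.
  by rewrite tt; lra.
have -> : theta * gammaT theta * dot u u = theta ^ 2 * dot u u * (/ (1 - tau)) ^ 2.
  by rewrite /gammaT -/tau; field; lra.
apply: (Rmult_le_reg_l ((1 - tau) ^ 2)); first by nra.
have -> : (1 - tau) ^ 2 * (tau / (1 - tau) * (dot a a - dot v v)
   + theta ^ 2 * dot u u * (/ (1 - tau)) ^ 2) =
   (1 - tau) * tau * (dot a a - dot v v) + theta ^ 2 * dot u u by field; lra.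
lra.
Qed.

(** The hypotheses give del N + D <= 2 D + c (a_k - a_{k+1}) with D <= E_k - E_{k+1}. If every index
    exceeded the threshold T, telescoping would yield K T < 2 (E_0 - v), contradicting the choice of
    T. *)
Lemma exists_below_average (E D N a : nat -> R) v del c K : (0 < K)%N ->
  (forall k, E k.+1 + D k <= E k) -> (forall k, v <= E k) ->
  (forall k, del * N k <= D k + c * (a k - a k.+1)) ->
  a 0%N = 0 -> (forall k, 0 <= a k) -> 0 <= c ->
  exists2 j, (j < K)%N & del * N j + D j <= 2 * (E 0%N - v) / INR K.
Proof.
move=> K1 ED vE NE a0 age c0; apply: NNPP => no.
set T := 2 * (E 0%N - v) / INR K in no.
have big j : (j < K)%N -> T < del * N j + D j.
  by move=> jK; apply: Rnot_le_lt => h; apply: no; exists j.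
have acc k : (k < K)%N -> INR k.+1 * T < 2 * (E 0%N - E k.+1) - c * a k.+1.
  elim: k => [|k IHk] kK.
    by have := big _ kK; have := ED 0%N; have := NE 0%N; rewrite a0 /=; lra.
  have := IHk (ltnW kK); have := big _ kK; have := ED k.+1; have := NE k.+1.
  rewrite (S_INR k.+1); lra.
case: K K1 @T no big acc => // K _ T no big acc.
have K0 : 0 < INR K.+1 by apply: lt_0_INR; apply/ltP.
have := acc K (ltnSn _); have := vE K.+1; have := age K.+1.
have -> : INR K.+1 * T = 2 * (E 0%N - v) by rewrite /T; field; lra.
nra.
Qed.

(** Once E drops below v it stays there, and l then loses at least the fixed gap at every step until
    it becomes negative. *)
Lemma lower_bound_of_telescoping (E l : nat -> R) v :
  (forall k, E k.+1 <= E k) -> (forall k, 0 <= l k) ->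
  (forall k, l k.+1 - l k <= E k.+1 - v) -> forall k, v <= E k.
Proof.
move=> Emono l0 hl k0; apply: Rnot_lt_le => h.
have Ek j : E (k0 + j)%N <= E k0.
  elim: j => [|j IHj]; first by rewrite addn0; lra.
  by have := Emono (k0 + j)%N; rewrite addnS; lra.
have lk j : l (k0 + j)%N <= l k0 - INR j * (v - E k0).
  elim: j => [|j IHj]; first by rewrite addn0 /=; lra.
  by have := hl (k0 + j)%N; have := Ek j.+1; rewrite addnS S_INR; lra.
have e0 : 0 < v - E k0 by lra.
have [j hj] := INR_unbounded (l k0 / (v - E k0)).
have := lk j; have := l0 (k0 + j)%N.
have : l k0 < INR j * (v - E k0).
  have -> : l k0 = l k0 / (v - E k0) * (v - E k0) by field; lra.
  exact: Rmult_lt_compat_r.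
lra.
Qed.

Lemma bigmin_le (F : nat -> R) z p l : (l < p)%N -> \big[Rmin/z]_(i < p) F i <= F l.
Proof.
elim: p F l => // p IHp F [|l] lp; rewrite big_ord_recl /=; first exact: Rmin_l.
by apply: Rle_trans (Rmin_r _ _) _; exact: (IHp (fun i => F i.+1) l lp).
Qed.

Lemma bigmin_gt0 (F : nat -> R) z p : 0 < z -> (forall l, (l < p)%N -> 0 < F l) ->
  0 < \big[Rmin/z]_(i < p) F i.
Proof. by move=> z0 h; elim/big_ind: _ => //; [exact: Rmin_pos | move=> i _; exact: h]. Qed.

Lemma bigmax_ge (F : nat -> R) z p l : (l < p)%N -> F l <= \big[Rmax/z]_(i < p) F i.
Proof.
elim: p F l => // p IHp F [|l] lp; rewrite big_ord_recl /=; first exact: Rmax_l.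
by apply: Rle_trans (Rmax_r _ _); exact: (IHp (fun i => F i.+1) l lp).
Qed.

Lemma bigmax_ge0 (F : nat -> R) p : 0 <= \big[Rmax/0]_(i < p) F i.
Proof.
elim: p F => [|p IHp] F; first by rewrite big_ord0; lra.
by rewrite big_ord_recl; apply: Rle_trans (IHp (fun i => F i.+1)) _; exact: Rmax_r.
Qed.

Lemma is_glb_exists (P : R -> Prop) : (exists r, P r) -> (exists l, forall r, P r -> l <= r) ->
  exists g, is_glb P g.
Proof.
move=> [r0 Pr0] [l lP]; case: (completeness (fun r => P (- r))) => [||s [ub lub]].
- by exists (- l) => r /lP; lra.
- by exists (- r0); rewrite Ropp_involutive.
exists (- s); split=> [r Pr|g gP].
  by have := ub (- r); rewrite Ropp_involutive => /(_ Pr); lra.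
by have := lub (- g) (fun r Pr => ltac:(by have := gP _ Pr; lra)); lra.
Qed.

(** The penalty increases with beta, so a lower bound at [bbar] persists at [beta]; hence the
    infimum exists and [vval] is not the default of [pickR]. *)
Lemma vval_le (p : nat) (n : nat -> nat) d (A : forall i, mat d (n i)) (b : vec d)
    (f : forall i, vec (n i) -> option R) bbar beta :
  bbar <= beta -> (exists lb, forall r, pen_set p A b f bbar r -> lb <= r) ->
  forall x, blocks_dom p f x ->
  vval p A b f beta <= \big[Rplus/0]_(i < p) rv (f i (x i))
                       + beta / 2 * vnorm (resid p A b x) ^ 2.
Proof.
move=> bb [lb hlb] x xd.
have pen y beta' : blocks_dom p f y -> pen_set p A b f beta'
    (\big[Rplus/0]_(i < p) rv (f i (y i)) + beta' / 2 * vnorm (resid p A b y) ^ 2).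
  by move=> yd; exists y; rewrite (fsum_dom yd).
have [h _] : is_glb (pen_set p A b f beta) (vval p A b f beta).
  apply: pickR_spec; apply: is_glb_exists; first by eexists; exact: pen xd.
  exists lb => r [y]; rewrite /fsum.
  move E : (\big[oadd/Some 0]_(i < p) f i (y i)) => [s|] //= [<-].
  have : lb <= s + bbar / 2 * vnorm (resid p A b y) ^ 2.
    by apply: hlb; exists y; rewrite /fsum E.
  have := pow2_ge_0 (vnorm (resid p A b y)); nra.
exact: h (pen _ _ xd).
Qed.

(** * The iteration *)

Unset Implicit Arguments.

Lemma dot_mT d n (A : mat d n) (z : vec d) (y : vec n) :
  dot (mapply (mT A) z) y = dot z (mapply A y).
Proof. by rewrite dot_mapplyr. Qed.

Lemma dot_le_of_vnorm_le n k (u : vec n) (v : vec k) c :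
  vnorm u <= c * vnorm v -> dot u u <= c ^ 2 * dot v v.
Proof.
by move=> h; have := vnorm_ge0 u; rewrite -!vnorm_sq => u0; nra.
Qed.

Lemma dot_sub_le n (u v : vec n) : dot (vsub u v) (vsub u v) <= 2 * dot u u + 2 * dot v v.
Proof. by have := dot_ge0 (vadd u v); rewrite !(dotBl, dotBr) !(dotDl, dotDr); lra. Qed.

(** The first-order remainder at z is exactly beta/2 |A_i (y - z)|^2. *)
Lemma quad_part_has_grad p (n : nat -> nat) d (A : forall i, mat d (n i)) b beta
    (x : forall i, vec (n i)) lam i (z : vec (n i)) :
  has_grad (fun y : vec (n i) => quad_part p A b beta x lam y) z
    (mapply (mT (A i)) (vsub (vscal beta (vadd (resid p A b x) (mapply (A i) (vsub z (x i))))) lam)).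
Proof.
have [C C0 hC] := mapply_bounded (A i).
apply: (has_grad_quadratic (C := Rabs (beta / 2) * C ^ 2)) => y.
have -> : quad_part p A b beta x lam y - quad_part p A b beta x lam z -
    dot (mapply (mT (A i)) (vsub (vscal beta (vadd (resid p A b x)
      (mapply (A i) (vsub z (x i))))) lam)) (vsub y z) =
    beta / 2 * dot (mapply (A i) (vsub y z)) (mapply (A i) (vsub y z)).
  have yzx : vsub y (x i) = vadd (vsub z (x i)) (vsub y z).
    by apply: functional_extensionality => t; rewrite /vadd /vsub; ring.
  rewrite /quad_part dot_mT yzx mapplyD.
  move: (resid p A b x) (mapply (A i) (vsub z (x i))) (mapply (A i) (vsub y z)) => r a e.
  rewrite !(dotBl, dotZl) !(dotDl, dotDr) (dotC e a); lra.
rewrite Rabs_mult (Rabs_right (dot _ _)); last by have := dot_ge0 (mapply (A i) (vsub y z)); lra.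
rewrite Rmult_assoc; apply: Rmult_le_compat_l; first exact: Rabs_pos.
by rewrite vnorm_sq; apply: dot_le_of_vnorm_le; exact: hC.
Qed.

(** The block gradient sees only the move of block [i], whereas [lamhat] uses the residual after all
    moves. The terms j <> i by which they differ are what [Rres] collects. *)
Lemma stationarity_residual p (n : nat -> nat) d (A : forall i, mat d (n i)) beta (r l : vec d)
    (D : forall j, vec (n j)) i (g : vec (n i)) : (i < p)%N ->
  vscal (-1) (vadd (mapply (mT (A i)) (vsub (vscal beta (vadd r (mapply (A i) (D i)))) l)) g) =
  vsub (mapply (mT (A i)) (vsub l (vscal beta (vadd r
          (fun t => \big[Rplus/0]_(j < p) mapply (A j) (D j) t)))))
       (vadd (vscal (-1) (fun t => \big[Rplus/0]_(j < p | nat_of_ord j != i)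
          (beta * mapply (mT (A i)) (mapply (A j) (D j)) t))) g).
Proof.
move=> ip; rewrite !mapplyB !mapplyZ !mapplyD.
rewrite (mapply_sum _ (mT (A i)) (fun j : 'I_p => mapply (A j) (D j))).
apply: functional_extensionality => t; rewrite /vsub /vadd /vscal bsumZ.
rewrite [X in _ = _ - beta * (_ + X) - _](bigD1 (Ordinal ip)) //=.
rewrite (eq_bigl (fun j : 'I_p => j != Ordinal ip)) //; ring.
Qed.

Section Iteration.
Context (q : nat) (n : nat -> nat) (d : nat) (A : forall i, mat d (n i)) (b : vec d)
  (f : forall i, vec (n i) -> option R) (gfp : vec (n q) -> vec (n q))
  (Lp beta alpha theta : R) (m M : nat -> R)
  (w : nat -> forall i, vec (n i) -> R) (gw : nat -> forall i, vec (n i) -> vec (n i))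
  (x : nat -> forall i, vec (n i)) (lam : nat -> vec d).
Context (q_gt0 : (0 < q)%N)
  (Aq_neq0 : exists r c, A q r c <> 0)
  (b_in_im : exists z, mapply (A q) z = b)
  (A_in_im : forall i, (i < q)%N -> forall y : vec (n i), exists z, mapply (A q) z = mapply (A i) y)
  (fq_finite : forall z, f q z <> None)
  (fq_grad : forall z, has_grad (fun y => rv (f q y)) z (gfp z))
  (gfp_lip : forall z z', vnorm (vsub (gfp z) (gfp z')) <= Lp * vnorm (vsub z z'))
  (alpha_gt0 : 0 < alpha) (beta_gt0 : 0 < beta)
  (m_le_M : forall i, (i < q.+1)%N -> 0 < m i /\ m i <= M i)
  (theta_bd : 0 < theta < 2)
  (delta_gt0 : forall i, (i < q.+1)%N -> 0 < delta q.+1 A Lp beta alpha theta m M i)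
  (x0_dom : forall i, (i < q.+1)%N -> dom (f i) (x 0%nat i))
  (w_in_D : forall k i, (i < q.+1)%N -> in_D (dom (f i)) (m i) (M i) (w k.+1 i) (gw k.+1 i))
  (x_min : forall k i, (i < q.+1)%N -> forall y : vec (n i),
     ele (oadd (Lag q.+1 A b f beta (upd (x k) i (x k.+1 i)) (lam k))
               (Some (breg (w k.+1 i) (gw k.+1 i) (x k i) (x k.+1 i))))
         (oadd (Lag q.+1 A b f beta (upd (x k) i y) (lam k))
               (Some (breg (w k.+1 i) (gw k.+1 i) (x k i) y))))
  (lam_step : forall k, lam k.+1 = vsub (lam k) (vscal (theta * beta) (resid q.+1 A b (x k.+1)))).

Local Notation res k := (resid q.+1 A b (x k)).
Local Notation At := (mapply (mT (A q))).

Lemma iterates_dom k : blocks_dom q.+1 f (x k).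
Proof.
elim: k => [|k IHk] i iq; first exact: x0_dom.
by have [] := block_min iq IHk (x_min k i iq).
Qed.

Lemma block_le k i (y : vec (n i)) : (i < q.+1)%N -> dom (f i) y ->
  rv (f i (x k.+1 i)) + (quad_part q.+1 A b beta (x k) (lam k) (x k.+1 i)
    + breg (w k.+1 i) (gw k.+1 i) (x k i) (x k.+1 i)) <=
  rv (f i y) + (quad_part q.+1 A b beta (x k) (lam k) y
    + breg (w k.+1 i) (gw k.+1 i) (x k i) y).
Proof. by move=> iq; have [_] := block_min iq (iterates_dom k) (x_min k i iq); apply. Qed.

(** The subgradient is kept in Frechet form so that, for the smooth last block, it can be identified
    with the gradient. *)
Lemma block_stationary k i : (i < q.+1)%N ->
  frechet_subdiff (f i) (x k.+1 i)
    (vsub (mapply (mT (A i)) (lamhat q.+1 A b beta x lam k.+1)) (Rres q.+1 A beta gw x k.+1 i)).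
Proof.
move=> iq; have xd := iterates_dom k.+1 i iq; have [wgrad _] := w_in_D k i iq.
have := fermat_frechet xd (fun y => block_le k i y iq)
  (has_gradD (quad_part_has_grad q.+1 n d A b beta (x k) (lam k) i (x k.+1 i))
     (breg_has_grad (x k i) (wgrad _ xd))).
congr (frechet_subdiff _ _ _); rewrite /lamhat /Rres (resid_sub q.+1 A b (x k) (x k.+1)) /=.
exact: (stationarity_residual q.+1 n d A beta (res k) (lam k)
  (fun j => vsub (x k.+1 j) (x k j)) i _ iq).
Qed.

Lemma grad_stationary k :
  gfp (x k.+1 q) =
  vsub (At (lamhat q.+1 A b beta x lam k.+1)) (Rres q.+1 A beta gw x k.+1 q).
Proof.
symmetry; apply: (frechet_differentiable fq_finite (fq_grad _)).
exact: block_stationary (ltnSn q).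
Qed.

(** * Increments and the multiplier recursion *)

Definition dx k i : vec (n i) := vsub (x k i) (x k.-1 i).
(** Since [0.-1 = 0], [dx] and [dlam] vanish at k = 0, so the recursions need no separate start. *)
Definition dlam k : vec d := vsub (lam k) (lam k.-1).
Definition cross k : vec (n q) := fun t => \big[Rplus/0]_(j < q) At (mapply (A j) (dx k j)) t.

(* [dual_image k] below is A_p^* lamhat^k for k >= 1.  The value of [dw] at 0 is chosen so that
   [dual_image 0] is A_p^* lam^0, which starts the recursion [At_dlam_rec] at k = 0; its square
   is the source of eta_0. *)
Definition dw k : vec (n q) :=
  if k is k'.+1 then vsub (gw k q (x k q)) (gw k q (x k' q))
  else vsub (At (lam 0%N)) (gfp (x 0%N q)).
Definition dual_image k : vec (n q) := vadd (vsub (gfp (x k q)) (vscal beta (cross k))) (dw k).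

Lemma dx0 i : dx 0 i = @vzero (n i).
Proof. exact: vsub_diag. Qed.

Lemma cross0 : cross 0 = @vzero (n q).
Proof.
apply: functional_extensionality => t; rewrite /cross big1 // => j _.
by rewrite dx0 !mapply0.
Qed.

Lemma Rres_last k : Rres q.+1 A beta gw x k.+1 q = vadd (vscal (- beta) (cross k.+1)) (dw k.+1).
Proof.
rewrite /Rres /cross /dx /=; apply: functional_extensionality => t.
rewrite /vadd /vscal bsumZ big_mkcond big_ord_recr /= eqxx /=.
rewrite (eq_bigr (fun j : 'I_q => At (mapply (A j) (vsub (x k.+1 j) (x k j))) t)); last first.
  by move=> j _; rewrite neq_ltn ltn_ord.
ring.
Qed.

Lemma dual_image0 : dual_image 0 = At (lam 0%N).
Proof.
rewrite /dual_image cross0 /=; apply: functional_extensionality => t.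
by rewrite /vadd /vsub /vscal /vzero; ring.
Qed.

Lemma dual_imageS k : dual_image k.+1 = At (lamhat q.+1 A b beta x lam k.+1).
Proof.
rewrite /dual_image grad_stationary Rres_last; apply: functional_extensionality => t.
by rewrite /vadd /vsub /vscal; ring.
Qed.

Lemma dlamS k : dlam k.+1 = vscal (- (theta * beta)) (res k.+1).
Proof.
by rewrite /dlam lam_step /=; apply: functional_extensionality => t; rewrite /vsub /vscal; ring.
Qed.

Lemma At_dlamS k : At (dlam k.+1) = vscal theta (vsub (dual_image k.+1) (At (lam k))).
Proof.
rewrite dual_imageS -mapplyB -mapplyZ dlamS; congr (mapply _ _).
by apply: functional_extensionality => t; rewrite /lamhat /vsub /vscal /=; ring.
Qed.

(** As dlam^k = theta (lamhat^k - lam^{k-1}), one has theta (lamhat^k - lam^k) = (1 - theta) dlam^k;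
    at k = 0 both sides vanish by the choice of [dw 0]. *)
Lemma dual_image_sub_At_lam k : vscal theta (vsub (dual_image k) (At (lam k))) = vscal (1 - theta)
  (At (dlam k)).
Proof.
case: k => [|k].
  rewrite dual_image0 vsub_diag /dlam vsub_diag mapply0.
  by apply: functional_extensionality => t; rewrite /vscal /vzero; ring.
have h := At_dlamS k; apply: functional_extensionality => t.
have := congr1 (fun v => v t) h; rewrite /dlam /= mapplyB /vscal /vsub; lra.
Qed.

Lemma At_dlam_rec k :
  At (dlam k.+1) = vadd (vscal (1 - theta) (At (dlam k))) (vscal theta (vsub (dual_image k.+1)
    (dual_image k))).
Proof.
rewrite -dual_image_sub_At_lam At_dlamS; apply: functional_extensionality => t.
by rewrite /vadd /vscal /vsub; ring.
Qed.

(** * Bounds on the multiplier increment *)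

Definition sq_dx k i : R := dot (dx k i) (dx k i).
Definition sum_sq_dx k : R := \big[Rplus/0]_(i < q) sq_dx k i.
Definition sq_dw k : R := dot (dw k) (dw k).
Definition sq_dlam k : R := dot (dlam k) (dlam k).
Definition sq_At_dlam k : R := dot (At (dlam k)) (At (dlam k)).
Definition sigma : R := sigAp q.+1 A.
Definition opAt : R := opnorm At.

Lemma sq_dx_ge0 k i : 0 <= sq_dx k i. Proof. exact: dot_ge0. Qed.
Lemma sum_sq_dx_ge0 k : 0 <= sum_sq_dx k. Proof. by apply: bsum_ge0 => i _; exact: sq_dx_ge0. Qed.
Lemma sq_dw_ge0 k : 0 <= sq_dw k. Proof. exact: dot_ge0. Qed.
Lemma maxA2_ge0 : 0 <= maxA2 q.+1 A.
Proof. exact: (bigmax_ge0 (fun l => opnorm (mapply (A l)) ^ 2)). Qed.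

(** Preimages of the terms A_i x_i are added up by induction on the number of blocks. This places
    [dlam] in Im A_q, where the eigenvalue bound [sigma] applies. *)
Lemma resid_in_image k : exists z, mapply (A q) z = res k.
Proof.
suff [z hz] : exists z, mapply (A q) z =
    (fun r => \big[Rplus/0]_(i < q.+1) mapply (A i) (x k i) r).
  have [zb hb] := b_in_im; exists (vsub z zb); rewrite mapplyB hz hb.
  exact: functional_extensionality.
have: forall r, (r <= q)%N -> exists z, mapply (A q) z =
    (fun t => \big[Rplus/0]_(i < r) mapply (A i) (x k i) t).
  elim=> [|r IHr] rq.
    by exists (@vzero (n q)); rewrite mapply0; apply: functional_extensionality => t; rewrite big_ord0.
  have [z hz] := IHr (ltnW rq); have [y hy] := A_in_im r rq (x k r).
  exists (vadd z y); rewrite mapplyD hz hy.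
  by apply: functional_extensionality => t; rewrite big_ord_recr.
move=> /(_ q (leqnn q)) [z hz]; exists (vadd z (x k q)); rewrite mapplyD hz.
by apply: functional_extensionality => t; rewrite big_ord_recr.
Qed.

Lemma sigma_gt0 : 0 < sigma.
Proof. by have [] := smallest_pos_eig_spec Aq_neq0. Qed.

Lemma sigma_sq_dlam_le k : sigma * sq_dlam k.+1 <= sq_At_dlam k.+1.
Proof.
have [_ h] := smallest_pos_eig_spec Aq_neq0; have [z hz] := resid_in_image k.+1.
have := h (vscal (- (theta * beta)) z).
by rewrite mapplyZ hz -dlamS !vnorm_sq.
Qed.

Lemma sq_dw_le k : sq_dw k.+1 <= M q ^ 2 * sq_dx k.+1 q.
Proof.
have [_ [_ lip]] := w_in_D k q (ltnSn q).
by apply: dot_le_of_vnorm_le; apply: lip; exact: iterates_dom.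
Qed.

(** The step splits into a gradient difference, a difference of [dw] and [q] cross terms. Only the
    newer [dw] is bounded through [dx]: the older one may be [dw 0], which is not a difference of
    gradients of a distance generating function. *)
Lemma dot_dual_image_step_le k :
  dot (vsub (dual_image k.+1) (dual_image k)) (vsub (dual_image k.+1) (dual_image k)) <=
  (INR q + 2) * ((Lp ^ 2 + 2 * M q ^ 2) * sq_dx k.+1 q + 2 * sq_dw k
     + 2 * beta ^ 2 * opAt ^ 2 * maxA2 q.+1 A * (sum_sq_dx k.+1 + sum_sq_dx k)).
Proof.
pose F j := vscal (- beta) (At (mapply (A j) (vsub (dx k.+1 j) (dx k j)))).
have -> : vsub (dual_image k.+1) (dual_image k) =
    vadd (vadd (vsub (gfp (x k.+1 q)) (gfp (x k q))) (vsub (dw k.+1) (dw k)))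
         (fun t => \big[Rplus/0]_(j < q) F j t).
  apply: functional_extensionality => t; rewrite /dual_image /F /cross /vadd /vsub /vscal bsumZ.
  under [X in _ = _ + _ * X]eq_bigr => j _ do
    rewrite (mapplyB _ (dx k.+1 j) (dx k j))
      (mapplyB _ (mapply (A j) (dx k.+1 j)) (mapply (A j) (dx k j))) /vsub.
  rewrite bsumB /=; ring.
apply: Rle_trans (dot_add_bsum_le F _ _ q_gt0) _.
apply: Rmult_le_compat_l; first by have := pos_INR q; lra.
have h1 : dot (vsub (gfp (x k.+1 q)) (gfp (x k q))) (vsub (gfp (x k.+1 q)) (gfp (x k q)))
    <= Lp ^ 2 * sq_dx k.+1 q by apply: dot_le_of_vnorm_le; exact: gfp_lip.
have h2 := dot_sub_le _ (dw k.+1) (dw k); rewrite -!/(sq_dw _) in h2.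
have h3 : \big[Rplus/0]_(j < q) dot (F j) (F j) <=
    2 * beta ^ 2 * opAt ^ 2 * maxA2 q.+1 A * (sum_sq_dx k.+1 + sum_sq_dx k).
  rewrite /sum_sq_dx -bsumD -bsumZ; apply: bsum_le => j _.
  rewrite /F dotZl dotZr.
  set v := vsub _ _; have [oA hA] := opnorm_mapply (A j); have [oT hT] := opnorm_mapply (mT (A q)).
  have i1 := dot_le_of_vnorm_le _ _ _ _ _ (hT (mapply (A j) v)).
  have i2 := dot_le_of_vnorm_le _ _ _ _ _ (hA v).
  have i3 : opnorm (mapply (A j)) ^ 2 <= maxA2 q.+1 A.
    exact: (bigmax_ge (fun l => opnorm (mapply (A l)) ^ 2) 0 (ltn_ord j)).
  have i4 : dot v v <= 2 * (sq_dx k.+1 j + sq_dx k j).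
    by have := dot_sub_le _ (dx k.+1 j) (dx k j); rewrite -/v -!/(sq_dx _ _); lra.
  have i5 : dot (mapply (A j) v) (mapply (A j) v) <= maxA2 q.+1 A * (2 * (sq_dx k.+1 j + sq_dx k j)).
    apply: Rle_trans i2 _; apply: Rmult_le_compat => //; [exact: pow2_ge_0 | exact: dot_ge0].
  have i6 : dot (At (mapply (A j) v)) (At (mapply (A j) v)) <=
      opAt ^ 2 * (maxA2 q.+1 A * (2 * (sq_dx k.+1 j + sq_dx k j))).
    apply: Rle_trans i1 _; apply: Rmult_le_compat_l => //; exact: pow2_ge_0.
  have : beta ^ 2 * dot (At (mapply (A j) v)) (At (mapply (A j) v)) <=
      beta ^ 2 * (opAt ^ 2 * (maxA2 q.+1 A * (2 * (sq_dx k.+1 j + sq_dx k j)))).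
    by apply: Rmult_le_compat_l => //; exact: pow2_ge_0.
  lra.
have := sq_dw_le k; lra.
Qed.

(** Each block minimiser is compared with staying put, and strong convexity of [w] yields the m_i/2
    terms. Summing the blocks accounts for each |u_i|^2 separately, while the simultaneous move
    costs |s|^2; the difference is the price of Jacobi updates. *)
Lemma primal_descent k :
  let u i := mapply (A i) (dx k.+1 i) in
  let s := fun t => \big[Rplus/0]_(i < q.+1) u i t in
  real_Lag q.+1 A b f beta (x k.+1) (lam k) <=
  real_Lag q.+1 A b f beta (x k) (lam k)
  + beta / 2 * (dot s s - \big[Rplus/0]_(i < q.+1) dot (u i) (u i))
  - \big[Rplus/0]_(i < q.+1) (m i / 2 * sq_dx k.+1 i).
Proof.
move=> u s; pose r := res k.
have block (i : 'I_q.+1) : rv (f i (x k.+1 i)) + ((dot (vsub (vscal beta r) (lam k)) (u i)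
    + beta / 2 * dot (u i) (u i)) + m i / 2 * sq_dx k.+1 i) <= rv (f i (x k i)).
  have h := block_le k i (x k i) (ltn_ord i) (iterates_dom k i (ltn_ord i)).
  have [_ [strong _]] := w_in_D k i (ltn_ord i).
  have {strong} := strong _ _ (iterates_dom k i (ltn_ord i)) (iterates_dom k.+1 i (ltn_ord i)).
  move: h; rewrite vnorm_sq /quad_part /breg !vsub_diag !mapply0.
  rewrite -/r -/(dx k.+1 i) -/(sq_dx k.+1 i) -/(u i).
  rewrite !(dotC _ (@vzero _)) !dot0l; lra.
have := bsum_le (P := xpredT) (fun i _ => block i).
rewrite !bsumD bsumZ /real_Lag !vnorm_sq (resid_sub q.+1 A b (x k) (x k.+1)) -/r -/s.
rewrite -(dot_sumr _ (vsub (vscal beta r) (lam k)) (fun i : 'I_q.+1 => u i)) -/s /=.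
move: s => s; move: (r) => r'.
rewrite !(dotBl, dotZl) !(dotDl, dotDr) (dotC s r'); lra.
Qed.

Lemma real_Lag_dual_step k :
  real_Lag q.+1 A b f beta (x k.+1) (lam k.+1) =
  real_Lag q.+1 A b f beta (x k.+1) (lam k) + sq_dlam k.+1 / (theta * beta).
Proof.
rewrite /sq_dlam dlamS /real_Lag lam_step; move: (res k.+1) => r.
by rewrite !(dotBl, dotZl, dotZr); field; lra.
Qed.

Definition tau : R := Rabs (theta - 1).
Definition step_bound k : R := (Lp ^ 2 + 2 * M q ^ 2) * sq_dx k.+1 q + 2 * sq_dw k
  + 2 * beta ^ 2 * opAt ^ 2 * maxA2 q.+1 A * (sum_sq_dx k.+1 + sum_sq_dx k).

Lemma tau_bd : 0 <= tau < 1.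
Proof. by rewrite /tau; split_Rabs; lra. Qed.

Lemma gammaT_gt0 : 0 < gammaT theta.
Proof.
rewrite /gammaT -/tau; have [_ t1] := tau_bd.
by apply: Rdiv_lt_0_compat; [lra | nra].
Qed.

Lemma dual_bound k :
  sq_dlam k.+1 <= tau / (1 - tau) / sigma * (sq_At_dlam k - sq_At_dlam k.+1)
            + theta * (gammaT theta * (INR q + 2) / sigma) * step_bound k.
Proof.
have s0 := sigma_gt0; have g0 := gammaT_gt0; have [t0 t1] := tau_bd.
apply: (Rmult_le_reg_l sigma) => //.
have -> : sigma * (tau / (1 - tau) / sigma * (sq_At_dlam k - sq_At_dlam k.+1)
    + theta * (gammaT theta * (INR q + 2) / sigma) * step_bound k) =
    tau / (1 - tau) * (sq_At_dlam k - sq_At_dlam k.+1) + theta * gammaT theta * ((INR q + 2) *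
      step_bound k) by field; lra.
apply: Rle_trans (sigma_sq_dlam_le k) _.
have := dual_recursion_bound (At (dlam k)) (vsub (dual_image k.+1) (dual_image k)) theta_bd.
rewrite -At_dlam_rec /= -/tau -!/(sq_At_dlam _).
have : theta * gammaT theta * dot (vsub (dual_image k.+1) (dual_image k)) (vsub (dual_image k.+1)
  (dual_image k)) <=
    theta * gammaT theta * ((INR q + 2) * step_bound k).
  by apply: Rmult_le_compat_l (dot_dual_image_step_le k); nra.
lra.
Qed.

(** * The energy and its decrease *)

Local Notation dlt i := (delta q.+1 A Lp beta alpha theta m M i).
Local Notation mind := (min_delta q.+1 A Lp beta alpha theta m M).
Local Notation mA := (maxA2 q.+1 A).

Definition dual_gain : R := gammaT theta * (INR q + 2) / sigma.
(** [block_loss] and [last_loss] are the amounts subtracted from m_i/4 in [delta], with q = p -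
    1. *)
Definition block_loss : R := (INR q - 1 + alpha) / 2 * beta * mA + 2 * dual_gain * opAt ^ 2 * beta * mA.
Definition last_loss : R := beta * INR q * opnorm (mapply (A q)) ^ 2 / (2 * alpha)
  + dual_gain * (Lp ^ 2 + 2 * M q ^ 2) / beta.

Lemma dual_gain_gt0 : 0 < dual_gain.
Proof.
have := gammaT_gt0; have := sigma_gt0; have := pos_INR q => *.
by apply: Rdiv_lt_0_compat => //; nra.
Qed.

Lemma delta_lt i : (i < q)%N -> dlt i = m i / 4 - block_loss.
Proof.
move=> iq; rewrite /delta -[q.+1.-1]/q iq S_INR /block_loss /dual_gain /sigma /sigAp -[q.+1.-1]/q
  /opAt /Rdiv.
ring.
Qed.

Lemma delta_last : dlt q = m q / 4 - last_loss.
Proof.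
rewrite /delta -[q.+1.-1]/q ltnn S_INR /last_loss /dual_gain.
have := sigma_gt0; rewrite /sigma /sigAp -[q.+1.-1]/q => s0.
by field; lra.
Qed.

Definition wsum_sq_dx k : R := \big[Rplus/0]_(i < q) (m i * sq_dx k i).
Definition dual_weight : R := tau / (1 - tau) / sigma / (theta * beta).
Definition energy k : R := real_Lag q.+1 A b f beta (x k) (lam k)
  + (wsum_sq_dx k / 4 + m q / (4 * M q ^ 2) * sq_dw k + dual_weight * sq_At_dlam k).
(** Two consecutive increments appear because the multiplier bound involves both; for the last block
    the older one is measured by [sq_dw k / M q ^ 2]. *)
Definition decr k : R := \big[Rplus/0]_(i < q) (dlt i * (sq_dx k.+1 i + sq_dx k i))
  + dlt q * (sq_dx k.+1 q + sq_dw k / M q ^ 2).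

Lemma decr_sum k :
  \big[Rplus/0]_(i < q) (dlt i * (sq_dx k.+1 i + sq_dx k i)) = (wsum_sq_dx k.+1 + wsum_sq_dx k) / 4
    - block_loss * (sum_sq_dx k.+1 + sum_sq_dx k).
Proof.
rewrite (eq_bigr (fun i : 'I_q => (/ 4 * (m i * sq_dx k.+1 i) + / 4 * (m i * sq_dx k i))
    - (block_loss * sq_dx k.+1 i + block_loss * sq_dx k i))); last first.
  by move=> i _; rewrite delta_lt //; field.
rewrite bsumB !bsumD !bsumZ /wsum_sq_dx /sum_sq_dx /=; lra.
Qed.

Lemma M_last_gt0 : 0 < M q.
Proof. by have [] := m_le_M q (ltnSn q); lra. Qed.

Lemma primal_descent_bound k :
  real_Lag q.+1 A b f beta (x k.+1) (lam k) <=
  real_Lag q.+1 A b f beta (x k) (lam k)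
  + ((INR q - 1 + alpha) / 2 * beta * mA * sum_sq_dx k.+1
     + beta * INR q * opnorm (mapply (A q)) ^ 2 / (2 * alpha) * sq_dx k.+1 q)
  - (wsum_sq_dx k.+1 / 2 + m q / 2 * sq_dx k.+1 q).
Proof.
have q1 : 1 <= INR q by rewrite -[1]/(INR 1); apply: le_INR; apply/leP.
have := primal_descent k; set u := fun i => mapply (A i) (dx k.+1 i) => /= h.
have := dot_bsum_offdiag_le u q_gt0 alpha_gt0; move: h.
have -> : \big[Rplus/0]_(i < q.+1) (m i / 2 * sq_dx k.+1 i) = wsum_sq_dx k.+1 / 2 + m q / 2 * sq_dx
  k.+1 q.
  rewrite big_ord_recr /=; congr (_ + _).
  rewrite /wsum_sq_dx /Rdiv Rmult_comm -bsumZ; apply: eq_bigr => i _; ring.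
move: (_ - \big[Rplus/0]_(i < q.+1) dot (u i) (u i)) => off h1 h2.
have hq : dot (u q) (u q) <= opnorm (mapply (A q)) ^ 2 * sq_dx k.+1 q.
  by apply: dot_le_of_vnorm_le; have [_] := opnorm_mapply (A q); exact.
have hS : \big[Rplus/0]_(i < q) dot (u i) (u i) <= mA * sum_sq_dx k.+1.
  rewrite /sum_sq_dx -bsumZ; apply: bsum_le => j _.
  apply: Rle_trans (dot_le_of_vnorm_le _ _ _ _ _ ((opnorm_mapply (A j)).2 _)) _.
  apply: Rmult_le_compat_r; first exact: sq_dx_ge0.
  exact: (bigmax_ge (fun l => opnorm (mapply (A l)) ^ 2) 0 (ltn_ord j)).
have qa : 0 < INR q / alpha by apply: Rdiv_lt_0_compat; lra.
have h3 : off <= (INR q - 1 + alpha) * (mA * sum_sq_dx k.+1)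
    + INR q / alpha * (opnorm (mapply (A q)) ^ 2 * sq_dx k.+1 q).
  apply: Rle_trans h2 _; apply: Rplus_le_compat; apply: Rmult_le_compat_l => //; lra.
have -> : beta * INR q * opnorm (mapply (A q)) ^ 2 / (2 * alpha) * sq_dx k.+1 q =
   beta / 2 * (INR q / alpha * (opnorm (mapply (A q)) ^ 2 * sq_dx k.+1 q)) by field; lra.
nra.
Qed.

(** Of the m_i/2 gained by the primal step, one half pays for the losses at k + 1 and the other half
    is stored in the energy to pay for the same increment at the next step. *)
Lemma energy_step k : energy k.+1 + decr k <= energy k.
Proof.
have g0 := dual_gain_gt0; have M0 := M_last_gt0; have mA0 := maxA2_ge0.
have := primal_descent_bound k; have := dual_bound k; have := real_Lag_dual_step k.
rewrite /energy /decr decr_sum -/dual_gain => -> hN hP.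
have tb : 0 < theta * beta by nra.
have {}hN : sq_dlam k.+1 / (theta * beta) <= dual_weight * (sq_At_dlam k - sq_At_dlam k.+1) +
  dual_gain / beta * step_bound k.
  apply: (Rmult_le_reg_r (theta * beta)) => //.
  have -> : sq_dlam k.+1 / (theta * beta) * (theta * beta) = sq_dlam k.+1 by field; lra.
  have s0 := sigma_gt0; have [_ t1] := tau_bd.
  have -> : (dual_weight * (sq_At_dlam k - sq_At_dlam k.+1) + dual_gain / beta * step_bound k) *
    (theta * beta) =
    tau / (1 - tau) / sigma * (sq_At_dlam k - sq_At_dlam k.+1) + theta * dual_gain * step_bound k
      by rewrite /dual_weight; field; lra.
  by [].
have dq := delta_last; have dq0 := delta_gt0 q (ltnSn q).
(* For the last block the stored half is recorded through [dw], by the Lipschitz bound. *)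
have e'le : m q / (4 * M q ^ 2) * sq_dw k.+1 <= m q / 4 * sq_dx k.+1 q.
  have -> : m q / 4 * sq_dx k.+1 q = m q / (4 * M q ^ 2) * (M q ^ 2 * sq_dx k.+1 q) by field; lra.
  apply: Rmult_le_compat_l (sq_dw_le k); have [m0 _] := m_le_M q (ltnSn q).
  by apply/Rlt_le/Rdiv_lt_0_compat; nra.
have ele : dual_gain / beta * (2 * sq_dw k) + dlt q * (sq_dw k / M q ^ 2) <= m q / (4 * M q ^ 2) *
  sq_dw k.
  have -> : dual_gain / beta * (2 * sq_dw k) + dlt q * (sq_dw k / M q ^ 2) =
    (dual_gain * (2 * M q ^ 2) / beta + dlt q) * (sq_dw k / M q ^ 2) by field; lra.
  have -> : m q / (4 * M q ^ 2) * sq_dw k = m q / 4 * (sq_dw k / M q ^ 2) by field; lra.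
  apply: Rmult_le_compat_r.
    by apply: Rmult_le_pos (sq_dw_ge0 k) _; apply/Rlt_le/Rinv_0_lt_compat; nra.
  have : 0 <= dual_gain * Lp ^ 2 / beta.
    apply: Rmult_le_pos; first by have := pow2_ge_0 Lp; nra.
    exact/Rlt_le/Rinv_0_lt_compat.
  have : 0 <= beta * INR q * opnorm (mapply (A q)) ^ 2 / (2 * alpha).
    apply: Rmult_le_pos; last by apply/Rlt_le/Rinv_0_lt_compat; lra.
    apply: Rmult_le_pos (pow2_ge_0 _); apply: Rmult_le_pos (pos_INR q); lra.
  rewrite dq /last_loss /Rdiv; lra.
have SE : dual_gain / beta * step_bound k = dual_gain * (Lp ^ 2 + 2 * M q ^ 2) / beta * sq_dx k.+1 q
    + dual_gain / beta * (2 * sq_dw k) + 2 * dual_gain * opAt ^ 2 * beta * mA * (sum_sq_dx k.+1 +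
      sum_sq_dx k).
  by rewrite /step_bound; field; lra.
(* [block_loss] charges the Jacobi cross terms to both increments, though they arise only at k + 1;
   this is the surplus. *)
have Sle : 0 <= (INR q - 1 + alpha) / 2 * beta * mA * sum_sq_dx k.
  have q1 : 1 <= INR q by rewrite -[1]/(INR 1); apply: le_INR; apply/leP.
  apply: Rmult_le_pos (sum_sq_dx_ge0 k); apply: Rmult_le_pos => //; nra.
rewrite SE /block_loss in hN *; rewrite dq /last_loss in ele *; lra.
Qed.
Lemma energy0 : energy 0 = real_Lag q.+1 A b f beta (x 0%N) (lam 0%N)
  + m q / (4 * M q ^ 2) * vnorm (vsub (At (lam 0%N)) (gfp (x 0%N q))) ^ 2.
Proof.
rewrite vnorm_sq /energy /wsum_sq_dx big1 => [|i _]; last by rewrite /sq_dx dx0 dot0l; ring.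
rewrite /sq_At_dlam /dlam /= vsub_diag mapply0 dot0l /sq_dw /dw; lra.
Qed.

Lemma sq_At_dlam0 : sq_At_dlam 0 = 0.
Proof. by rewrite /sq_At_dlam /dlam /= vsub_diag mapply0 dot0l. Qed.

Lemma sq_At_dlam_ge0 k : 0 <= sq_At_dlam k. Proof. exact: dot_ge0. Qed.

Lemma dual_weight_ge0 : 0 <= dual_weight.
Proof.
have [t0 t1] := tau_bd; have s0 := sigma_gt0.
have r0 : 0 <= tau / (1 - tau) by apply: Rmult_le_pos => //; apply/Rlt_le/Rinv_0_lt_compat; lra.
rewrite /dual_weight /Rdiv Rmult_assoc -Rinv_mult; apply: Rmult_le_pos => //.
by apply/Rlt_le/Rinv_0_lt_compat; apply: Rmult_lt_0_compat => //; nra.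
Qed.

Lemma mind_gt0 : 0 < mind.
Proof. by apply: (@bigmin_gt0 (fun l => dlt l)); [exact: delta_gt0 | exact: delta_gt0]. Qed.

Lemma mind_le i : (i < q.+1)%N -> mind <= dlt i.
Proof. exact: (@bigmin_le (fun l => dlt l)). Qed.

Lemma mind_decr k : mind * (sum_sq_dx k.+1 + sum_sq_dx k + (sq_dx k.+1 q + sq_dw k / M q ^ 2)) <= decr k.
Proof.
rewrite Rmult_plus_distr_l /decr /sum_sq_dx -bsumD -bsumZ; apply: Rplus_le_compat.
  apply: bsum_le => i _; apply: Rmult_le_compat_r; last by apply: mind_le; exact: ltnW (ltn_ord i).
  by have := sq_dx_ge0 k.+1 i; have := sq_dx_ge0 k i; lra.
apply: Rmult_le_compat_r (mind_le q (ltnSn q)).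
apply: Rplus_le_le_0_compat; first exact: sq_dx_ge0.
by apply: Rmult_le_pos (sq_dw_ge0 k) _; apply/Rlt_le/Rinv_0_lt_compat; have := M_last_gt0; nra.
Qed.

Lemma sq_dw_div_ge0 k : 0 <= sq_dw k / M q ^ 2.
Proof.
by apply: Rmult_le_pos (sq_dw_ge0 k) _; apply/Rlt_le/Rinv_0_lt_compat; have := M_last_gt0; nra.
Qed.

Lemma decr_ge0 k : 0 <= decr k.
Proof.
apply: Rle_trans (mind_decr k); apply: Rmult_le_pos; first exact/Rlt_le/mind_gt0.
have := sum_sq_dx_ge0 k.+1; have := sum_sq_dx_ge0 k; have := sq_dx_ge0 k.+1 q; have :=
  sq_dw_div_ge0 k; lra.
Qed.

Lemma mind_sq_dx_le k i : (i < q.+1)%N -> mind * sq_dx k.+1 i <= decr k.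
Proof.
move=> iq; apply: Rle_trans (mind_decr k); apply: Rmult_le_compat_l; first exact/Rlt_le/mind_gt0.
have := sum_sq_dx_ge0 k; have := sq_dx_ge0 k.+1 q; have := sq_dw_div_ge0 k.
case: (ltngtP i q) => [iq'|qi|->].
- have : sq_dx k.+1 i <= sum_sq_dx k.+1.
    exact: (bsum_ge_term (F := fun i : 'I_q => sq_dx k.+1 i) (j := Ordinal iq') isT
              (fun j _ => sq_dx_ge0 k.+1 j)).
  lra.
- by move: iq; rewrite ltnS leqNgt qi.
- have := sum_sq_dx_ge0 k.+1; lra.
Qed.

(** * The multiplier constant and the lower bound on the energy *)

Local Notation dlt_lam := (delta_lam q.+1 A Lp beta alpha theta m M).
Local Notation step_coef := (2 * beta ^ 2 * opAt ^ 2 * mA + Lp ^ 2 + 2 * M q ^ 2).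

Lemma step_coef_gt0 : 0 < step_coef.
Proof.
have M0 := M_last_gt0; have := pow2_ge_0 Lp; have := maxA2_ge0.
have := pow2_ge_0 opAt; have := pow2_ge_0 beta => h1 h2 h3 h4.
have : 0 <= 2 * beta ^ 2 * opAt ^ 2 * mA by apply: Rmult_le_pos => //; nra.
nra.
Qed.

Lemma delta_lamE : dlt_lam = / (theta * dual_gain / mind * step_coef).
Proof.
have := sigma_gt0; have := mind_gt0.
rewrite /delta_lam /dual_gain /sigma /sigAp /opAt -[q.+1.-1]/q S_INR => m0 s0.
by congr (/ _); field; lra.
Qed.

Lemma delta_lam_gt0 : 0 < dlt_lam.
Proof.
rewrite delta_lamE; have := mind_gt0; have := dual_gain_gt0; have := step_coef_gt0 => y0 g0 m0.
apply: Rinv_0_lt_compat; apply: Rmult_lt_0_compat => //.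
by apply: Rdiv_lt_0_compat => //; nra.
Qed.

(** [delta_lam] is the constant for which theta [dual_gain] [step_bound] is at most [decr] /
    [delta_lam]: [step_coef] dominates every coefficient of [step_bound], and [mind] those of [decr]
    from below. *)
Lemma delta_lam_sq_dlam_le k :
  dlt_lam * sq_dlam k.+1 <= decr k + dlt_lam * (tau / (1 - tau) / sigma) * (sq_At_dlam k -
    sq_At_dlam k.+1).
Proof.
have d0 := delta_lam_gt0; have g0 := dual_gain_gt0; have m0 := mind_gt0; have y0 := step_coef_gt0.
have Yle : step_bound k <= step_coef * (sum_sq_dx k.+1 + sum_sq_dx k + (sq_dx k.+1 q + sq_dw k / M
  q ^ 2)).
  have M0 := M_last_gt0; have L2 := pow2_ge_0 Lp; have M2 := pow2_ge_0 (M q).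
  have P0 : 0 <= 2 * beta ^ 2 * opAt ^ 2 * mA.
    by apply: Rmult_le_pos maxA2_ge0; have := pow2_ge_0 opAt; have := pow2_ge_0 beta; nra.
  have eE : 2 * sq_dw k = 2 * M q ^ 2 * (sq_dw k / M q ^ 2) by field; lra.
  have S1 := sum_sq_dx_ge0 k.+1; have S0 := sum_sq_dx_ge0 k; have X1 := sq_dx_ge0 k.+1 q; have e1
    := sq_dw_div_ge0 k.
  have i1 : 0 <= 2 * beta ^ 2 * opAt ^ 2 * mA * (sq_dx k.+1 q + sq_dw k / M q ^ 2).
    by apply: Rmult_le_pos => //; lra.
  have i2 : 0 <= Lp ^ 2 * (sum_sq_dx k.+1 + sum_sq_dx k + sq_dw k / M q ^ 2) by apply: Rmult_le_pos
    => //; lra.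
  have i3 : 0 <= M q ^ 2 * (sum_sq_dx k.+1 + sum_sq_dx k) by apply: Rmult_le_pos => //; lra.
  rewrite /step_bound eE; lra.
have step : theta * dual_gain * step_bound k <= / dlt_lam * decr k.
  rewrite delta_lamE Rinv_inv.
  have tg : 0 <= theta * dual_gain by nra.
  have M0 := M_last_gt0.
  apply: Rle_trans (Rmult_le_compat_l _ _ _ tg Yle) _.
  have -> : theta * dual_gain * (step_coef * (sum_sq_dx k.+1 + sum_sq_dx k + (sq_dx k.+1 q + sq_dw
    k / M q ^ 2))) =
     theta * dual_gain / mind * step_coef * (mind * (sum_sq_dx k.+1 + sum_sq_dx k + (sq_dx k.+1 q +
       sq_dw k / M q ^ 2))) by field; lra.
  apply: Rmult_le_compat_l (mind_decr k); apply: Rmult_le_pos; last exact: Rlt_le.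
  by apply: Rmult_le_pos => //; exact/Rlt_le/Rinv_0_lt_compat.
have := dual_bound k; rewrite -/dual_gain => h.
have {}h : sq_dlam k.+1 <= tau / (1 - tau) / sigma * (sq_At_dlam k - sq_At_dlam k.+1) + / dlt_lam *
  decr k by lra.
apply: Rle_trans (Rmult_le_compat_l _ _ _ (Rlt_le _ _ d0) h) _.
rewrite Rmult_plus_distr_l -!Rmult_assoc Rinv_r; lra.
Qed.

Lemma energy_ge_vval bbar : bbar <= beta ->
  (exists lb, forall r, pen_set q.+1 A b f bbar r -> lb <= r) ->
  forall k, vval q.+1 A b f beta <= energy k.
Proof.
move=> bb hlb; have tb : 0 < theta * beta by nra.
apply: (lower_bound_of_telescoping (l := fun k => dot (lam k) (lam k) / (2 * (theta * beta)))).
- by move=> k; have := energy_step k; have := decr_ge0 k; lra.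
- move=> k; apply: Rmult_le_pos (dot_ge0 _) _; apply/Rlt_le/Rinv_0_lt_compat; lra.
move=> k; have := vval_le (A := A) (b := b) bb hlb (iterates_dom k.+1).
have eta0 : 0 <= wsum_sq_dx k.+1 / 4 + m q / (4 * M q ^ 2) * sq_dw k.+1 + dual_weight * sq_At_dlam k.+1.
  have := M_last_gt0; have [m0 _] := m_le_M q (ltnSn q) => M0.
  have : 0 <= wsum_sq_dx k.+1.
    apply: bsum_ge0 => i _; apply: Rmult_le_pos (sq_dx_ge0 _ _).
    by have [] := m_le_M i (ltnW (ltn_ord i)); lra.
  have : 0 <= m q / (4 * M q ^ 2) * sq_dw k.+1.
    by apply: Rmult_le_pos (sq_dw_ge0 _); apply/Rlt_le/Rdiv_lt_0_compat; nra.
  have : 0 <= dual_weight * sq_At_dlam k.+1 by apply: Rmult_le_pos (sq_At_dlam_ge0 _); exact: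
    dual_weight_ge0.
  lra.
rewrite /energy /real_Lag => hv.
(* Substituting lam^k = lam^{k+1} + theta beta r turns the left side into -<lam^{k+1}, r> minus a
   nonnegative multiple of |r|^2. *)
suff : dot (lam k.+1) (lam k.+1) / (2 * (theta * beta)) - dot (lam k) (lam k) / (2 * (theta * beta))
    <= - dot (lam k.+1) (res k.+1) by lra.
have -> : lam k = vadd (lam k.+1) (vscal (theta * beta) (res k.+1)).
  by rewrite lam_step; apply: functional_extensionality => t; rewrite /vadd /vsub /vscal; ring.
move: (lam k.+1) (res k.+1) => l r.
rewrite !(dotDl, dotDr) !(dotZl, dotZr) (dotC r l).
have -> : dot l l / (2 * (theta * beta)) - (dot l l + theta * beta * dot l r +
   (theta * beta * dot l r + theta * beta * (theta * beta * dot r r))) / (2 * (theta * beta)) =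
   - dot l r - theta * beta / 2 * dot r r by field; lra.
have := dot_ge0 r; nra.
Qed.

(** * Rates for the residuals *)

Lemma vnorm_Rres_le k i c : (i < q.+1)%N -> (forall l, (l < q.+1)%N -> vnorm (dx k.+1 l) <= c) ->
  vnorm (Rres q.+1 A beta gw x k.+1 i) <=
  (\big[Rplus/0]_(l < q.+1 | nat_of_ord l != i)
     (beta * opnorm (fun z => mapply (mT (A i)) (mapply (A l) z))) + M i) * c.
Proof.
move=> iq hc; apply: Rle_trans (vnorm_add _ _) _.
rewrite Rmult_plus_distr_r; apply: Rplus_le_compat.
  rewrite vnorm_scal Rabs_Ropp Rabs_R1 Rmult_1_l.
  apply: Rle_trans (vnorm_sum _ (fun j : 'I_q.+1 =>
    vscal beta (mapply (mT (A i)) (mapply (A j) (dx k.+1 j))))) _.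
  rewrite Rmult_comm -bsumZ; apply: bsum_le => j _.
  rewrite vnorm_scal Rabs_right; last lra.
  have [o0 ho] := opnorm_mapply2 (mT (A i)) (A j).
  have h1 := ho (dx k.+1 j); have h2 := hc j (ltn_ord j).
  have -> : c * (beta * opnorm (fun z => mapply (mT (A i)) (mapply (A j) z))) =
    beta * (opnorm (fun z => mapply (mT (A i)) (mapply (A j) z)) * c) by ring.
  apply: Rmult_le_compat_l; first lra.
  by apply: Rle_trans h1 _; exact: Rmult_le_compat_l.
have [_ [_ lip]] := w_in_D k i iq.
apply: Rle_trans (lip _ _ (iterates_dom k.+1 i iq) (iterates_dom k i iq)) _.
by apply: Rmult_le_compat_l (hc i iq); have [] := m_le_M i iq; lra.
Qed.

Lemma vnorm_le_sqrt j (u : vec j) c del K D : 0 < K -> 0 < del -> 0 <= c ->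
  del * dot u u <= 2 * D / K -> c * vnorm u <= c * sqrt (2 * D / (K * del)).
Proof.
move=> K0 d0 c0 h; apply: Rmult_le_compat_l => //; apply: sqrt_le_1_alt.
apply: (Rmult_le_reg_l del) => //.
by have -> : del * (2 * D / (K * del)) = 2 * D / K by field; lra.
Qed.

Lemma vnorm_resE k : vnorm (res k.+1) = 1 / (beta * theta) * vnorm (dlam k.+1).
Proof.
have tb : 0 < theta * beta by nra.
rewrite dlamS vnorm_scal Rabs_Ropp Rabs_right; last lra.
by field; nra.
Qed.

Theorem jacobi_admm_bounds bbar : bbar <= beta ->
  (exists lb, forall r, pen_set q.+1 A b f bbar r -> lb <= r) ->
  let DL0 := energy 0 - vval q.+1 A b f beta in
  0 <= DL0 /\ forall K, (0 < K)%N -> exists2 j, (j < K)%N &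
    (forall i, (i < q.+1)%N ->
       vnorm (Rres q.+1 A beta gw x j.+1 i) <=
       (\big[Rplus/0]_(l < q.+1 | nat_of_ord l != i)
          (beta * opnorm (fun z => mapply (mT (A i)) (mapply (A l) z))) + M i)
       * sqrt (2 * DL0 / (INR K * mind))) /\
    vnorm (res j.+1) <= 1 / (beta * theta) * sqrt (2 * DL0 / (INR K * dlt_lam)).
Proof.
move=> bb hlb DL0; have Ev := energy_ge_vval bbar bb hlb.
split=> [|K Kpos]; first by have := Ev 0%N; rewrite /DL0; lra.
have K0 : 0 < INR K by apply: lt_0_INR; apply/ltP.
have d0 := delta_lam_gt0; have [t0 t1] := tau_bd.
have c0 : 0 <= dlt_lam * (tau / (1 - tau) / sigma).
  apply: Rmult_le_pos; first exact: Rlt_le.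
  apply: Rmult_le_pos; last exact/Rlt_le/Rinv_0_lt_compat/sigma_gt0.
  by apply: Rmult_le_pos => //; apply/Rlt_le/Rinv_0_lt_compat; lra.
(* A single index controls the sum of two nonnegative terms: [decr j] bounds every block increment,
   and the other term bounds the multiplier increment. *)
have [j jK hj] := exists_below_average (N := fun k => sq_dlam k.+1) Kpos energy_step Ev
  delta_lam_sq_dlam_le sq_At_dlam0 sq_At_dlam_ge0 c0.
have N0 : 0 <= sq_dlam j.+1 by exact: dot_ge0.
exists j => //; split=> [i iq|].
  apply: vnorm_Rres_le => // l lq; rewrite -[vnorm _]Rmult_1_l -[sqrt _]Rmult_1_l.
  apply: vnorm_le_sqrt => //; [exact: mind_gt0 | lra |].
  have := mind_sq_dx_le j l lq; rewrite /sq_dx /DL0; nra.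
rewrite vnorm_resE; apply: vnorm_le_sqrt => //.
  by apply/Rlt_le/Rdiv_lt_0_compat; nra.
by have := decr_ge0 j; rewrite -/(sq_dlam j.+1) /DL0; lra.
Qed.

End Iteration.

(* Blocks are indexed 0..p-1; block p.-1 is the paper's block p. *)
Theorem mainTheorem1
  (p : nat) (n : nat -> nat) (d : nat)
  (A : forall i, mat d (n i)) (b : vec d)
  (f : forall i, vec (n i) -> option R)
  (gfp : vec (n p.-1) -> vec (n p.-1)) (Lp : R)
  (bbar beta alpha theta : R) (m M : nat -> R)
  (w : nat -> forall i, vec (n i) -> R) (gw : nat -> forall i, vec (n i) -> vec (n i))
  (x : nat -> forall i, vec (n i)) (lam : nat -> vec d)
  (Hp : (2 <= p)%N)
  (* (A0) *)
  (HA0 : forall i, (i < p.-1)%N -> proper_fn (f i) /\ lsc (f i))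
  (* (A1) *)
  (HA1nz : exists r c, A p.-1 r c <> 0)
  (HA1b : exists z, mapply (A p.-1) z = b)
  (HA1im : forall i, (i < p.-1)%N -> forall y : vec (n i),
             exists z, mapply (A p.-1) z = mapply (A i) y)
  (* (A2) *)
  (HA2fin : forall z, f p.-1 z <> None)
  (HA2grad : forall z, has_grad (fun y => rv (f p.-1 y)) z (gfp z))
  (HLp : 0 <= Lp)
  (HA2lip : forall z z', vnorm (vsub (gfp z) (gfp z')) <= Lp * vnorm (vsub z z'))
  (* (A3) *)
  (Hbbar : 0 <= bbar)
  (HA3 : exists lb, forall r, pen_set p A b f bbar r -> lb <= r)
  (* parameters *)
  (Halpha : 0 < alpha) (Hbeta_bbar : bbar <= beta) (Hbeta : 0 < beta)
  (HmM : forall i, (i < p)%N -> 0 < m i /\ m i <= M i)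
  (Htheta : 0 < theta < 2)
  (Hdelta : forall i, (i < p)%N -> 0 < delta p A Lp beta alpha theta m M i)
  (* initial point in Z_1 x ... x Z_p *)
  (Hx0 : forall i, (i < p)%N -> dom (f i) (x 0%nat i))
  (* NEPJ-ADMM iteration, written for step k+1 (k >= 0) *)
  (Hw : forall k i, (i < p)%N ->
          in_D (dom (f i)) (m i) (M i) (w k.+1 i) (gw k.+1 i))
  (Hx : forall k i, (i < p)%N -> forall y : vec (n i),
          ele (oadd (Lag p A b f beta (upd (x k) i (x k.+1 i)) (lam k))
                    (Some (breg (w k.+1 i) (gw k.+1 i) (x k i) (x k.+1 i))))
              (oadd (Lag p A b f beta (upd (x k) i y) (lam k))
                    (Some (breg (w k.+1 i) (gw k.+1 i) (x k i) y))))
  (Hlam : forall k, lam k.+1 = vsub (lam k) (vscal (theta * beta) (resid p A b (x k.+1)))) :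
  let eta0 := m p.-1 / (4 * (M p.-1) ^ 2)
              * (vnorm (vsub (mapply (mT (A p.-1)) (lam 0%nat)) (gfp (x 0%nat p.-1)))) ^ 2 in
  let DL0 := rv (Lag p A b f beta (x 0%nat) (lam 0%nat)) - vval p A b f beta + eta0 in
  let mind := min_delta p A Lp beta alpha theta m M in
  0 <= DL0 /\
  forall k : nat, (1 <= k)%N ->
    (forall i, (i < p)%N ->
       exists g : vec (n i),
         limiting_subdiff (f i) (x k i) g /\
         vadd (vsub g (mapply (mT (A i)) (lamhat p A b beta x lam k)))
              (Rres p A beta gw x k i) = @vzero (n i)) /\
    exists j : nat, (1 <= j <= k)%N /\
      (forall i, (i < p)%N ->
         vnorm (Rres p A beta gw x j i)
         <= ((\big[Rplus/0]_(l < p | nat_of_ord l != i)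
                (beta * opnorm (fun z => mapply (mT (A i)) (mapply (A l) z)))) + M i)
            * sqrt (2 * DL0 / (INR k * mind))) /\
      vnorm (resid p A b (x j))
      <= 1 / (beta * theta) * sqrt (2 * DL0 / (INR k * delta_lam p A Lp beta alpha theta m M)).
Proof.
(* Writing p = q + 1 makes [p.-1] reduce to [q], so the types of the last block match. *)
destruct p as [|q]; first by [].
move=> eta0 DL0 mind.
have [DL0_ge0 bounds] := @jacobi_admm_bounds q n d A b f gfp Lp beta alpha theta m M w gw x lam
  Hp HA1nz HA1b HA1im HA2fin HA2grad HA2lip Halpha Hbeta HmM Htheta Hdelta Hx0 Hw Hx Hlam
  bbar Hbeta_bbar HA3.
have DL0E : DL0 = energy q n d A b f gfp beta theta m M gw x lam 0 - vval q.+1 A b f beta.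
  rewrite /DL0 /eta0 energy0 (Lag_dom A b beta (lam 0%N) (Hx0 : blocks_dom q.+1 f (x 0%N))).
  rewrite /rv -[q.+1.-1]/q; lra.
rewrite -DL0E in DL0_ge0 bounds; split=> // k k1; split=> [i iq|].
  (* The subgradient left open is A_i^T lamhat^k - R_i^k, supplied by [block_stationary]. *)
  case: k k1 => // k _; eexists; split.
    by apply: frechet_limiting; exact: (@block_stationary q n d A b f beta m M w gw x lam Hx0 Hw Hx).
  by apply: functional_extensionality => t; rewrite /vadd /vsub /vzero; ring.
have [j jk [hR hr]] := bounds k k1.
(* The averaged quantities at [j < k] concern iterate j + 1, which lies between 1 and k. *)
by exists j.+1; rewrite jk.
Qed.
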